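(* Let $T$ be a bounded operator on $L^2$. Then $T=S_{\alpha,\beta}$ for some $\alpha,\beta\in L^\infty$ with $\alpha$ analytic and $\beta$ co-analytic if and only if the following two conditions hold: (i) $T$ commutes with $S_{z,\bar z}$; (ii) $T\big(H^2-\{0\}\big)\cap H^2\neq\emptyset$ and $T\big(H^{2\bot}-\{0\}\big)\cap H^{2\bot}\neq\emptyset$ (that is, there is a nonzero $f\in H^2$ with $Tf\in H^2$ and a nonzero $g\in H^{2\bot}$ with $Tg\in H^{2\bot}$).
   Context: $S^1=\{z\in\mathbb{C}:|z|=1\}$ carries normalized Lebesgue measure; $L^2=L^2(S^1)$, $L^\infty=L^\infty(S^1)$ (complex-valued functions). $H^2$ is the Hardy space of all $f\in L^2$ whose negative Fourier coefficients vanish, and $H^{2\bot}$ is its orthogonal complement in $L^2$. $P$ and $Q=I-P$ are the orthogonal projections of $L^2$ onto $H^2$ and $H^{2\bot}$. For $\alpha,\beta\in L^\infty$, the operator $S_{\alpha,\beta}$ on $L^2$ is $S_{\alpha,\beta}f=\alpha Pf+\beta Qf$; in $S_{z,\bar z}$, $z$ and $\bar z$ denote the functions $z\mapsto z$ and $z\mapsto\bar z$ on $S^1$. A function in $L^2$ is analytic if it lies in $H^2$, and co-analytic if its complex conjugate is analytic. Bounded operators are linear. *)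

(* Defs.v *)
From HB Require Import structures.
From mathcomp Require Import all_boot all_order all_algebra.
From mathcomp Require Import all_classical all_reals all_analysis.
From mathcomp Require Import measurable_realfun complex.
From mathcomp Require Import ring lra.

Set Implicit Arguments.
Unset Strict Implicit.
Unset Printing Implicit Defensive.

Import Order.TTheory GRing.Theory Num.Theory.
Import numFieldNormedType.Exports.

Local Open Scope classical_set_scope.
Local Open Scope ring_scope.
Local Open Scope complex_scope.

Local Notation Re := complex.Re.
Local Notation Im := complex.Im.

Definition cabs (R : realType) (z : R[i]) : R := ComplexField.Normc.normc z.

Section Circle.
Variable R : realType.

Record circle := Circle { circle_val :> R[i]; _ : cabs circle_val == 1 }.

HB.instance Definition _ := [isSub for circle_val].
HB.instance Definition _ := [Choice of circle by <:].

Lemma cabs_expi (t : R) : cabs (cos t +i* sin t) == 1.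
Proof. by rewrite /cabs /= cos2Dsin2 sqrtr1. Qed.

Definition expi (t : R) : circle := Circle (cabs_expi t).

HB.instance Definition _ := isPointed.Build circle (expi 0).

Definition circle_pair (z : circle) : R * R := (Re z, Im z).

(* The Borel sigma-algebra of the circle, as a subspace of R * R. *)
HB.instance Definition _ :=
  Measurable.copy circle (g_sigma_algebra_preimageType circle_pair).

Lemma measurable_expi : measurable_fun setT expi.
Proof.
move=> _ _ [B mB <-]; rewrite !setTI.
have : measurable_fun setT (fun t : R => (cos t, sin t)).
  apply: measurable_fun_pair; apply: continuous_measurable_fun.
    exact: continuous_cos.
  exact: continuous_sin.
by move=> /(_ measurableT _ mB); rewrite setTI.
Qed.

HB.instance Definition _ := isMeasurableFun.Build _ _ (measurableTypeR R) _
  (expi : measurableTypeR R -> circle) measurable_expi.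

Lemma twopi_gt0 : 0 < 2 * pi :> R.
Proof. by rewrite mulr_gt0 ?pi_gt0. Qed.

(* Normalized Lebesgue measure: the image of the uniform probability on
   [0, 2 pi] under t |-> e^(it). *)
Definition circle_measure : probability circle R :=
  distribution (uniform_prob twopi_gt0) (expi : measurableTypeR R -> circle).

Definition zfun : circle -> R[i] := fun z => z.
Definition zbarfun : circle -> R[i] := fun z => (z : R[i])^*.
End Circle.

Section L2.
Variable R : realType.
Local Notation circle := (circle R).
Local Notation m := (circle_measure R).

(* R[i]^o is R[i] as a vector space over itself. *)
Local Notation cfun := (circle -> R[i]^o).

Definition cmeasurable (f : circle -> R[i]) : Prop :=
  measurable_fun setT (fun z => Re (f z)) /\
  measurable_fun setT (fun z => Im (f z)).

Definition cintegral (f : circle -> R[i]) : R[i] :=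
  (\int[m]_z Re (f z))%R +i* (\int[m]_z Im (f z))%R.

Definition square_integrable (f : circle -> R[i]) : Prop :=
  cmeasurable f /\ (\int[m]_z (cabs (f z) ^+ 2)%:E < +oo)%E.

Definition L2pred : {pred cfun} := mem [set f : cfun | square_integrable f].

Lemma cabs_ge0 (z : R[i]) : 0 <= cabs z.
Proof. by case: z => a b; rewrite /cabs/= sqrtr_ge0. Qed.

Lemma cabs2 (z : R[i]) : cabs z ^+ 2 = Re z ^+ 2 + Im z ^+ 2.
Proof. by case: z => a b; rewrite /cabs/= sqr_sqrtr// addr_ge0// sqr_ge0. Qed.

Lemma cmeasurable_cabs2 f : cmeasurable f ->
  measurable_fun setT (EFin \o (fun z => cabs (f z) ^+ 2)).
Proof.
move=> [mr mi]; apply/measurable_EFinP.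
under eq_fun do rewrite cabs2.
by apply: measurable_funD; exact: measurable_funX.
Qed.

Lemma cmeasurableM f g : cmeasurable f -> cmeasurable g ->
  cmeasurable (fun z => f z * g z).
Proof.
move=> [fr fi] [gr gi]; split.
- rewrite (_ : (fun z => _) = (fun z => Re (f z) * Re (g z) - Im (f z) * Im (g z))).
    by apply: measurable_funB; exact: measurable_funM.
  by apply/funext => z; case: (f z) (g z) => [a b] [c d].
- rewrite (_ : (fun z => _) = (fun z => Re (f z) * Im (g z) + Im (f z) * Re (g z))).
    by apply: measurable_funD; exact: measurable_funM.
  by apply/funext => z; case: (f z) (g z) => [a b] [c d].
Qed.

Lemma cmeasurable_cst (c : R[i]) : cmeasurable (fun=> c).
Proof. by split; exact: measurable_cst. Qed.

Lemma cmeasurableD f g : cmeasurable f -> cmeasurable g ->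
  cmeasurable (fun z => f z + g z).
Proof.
move=> [fr fi] [gr gi]; split.
- rewrite (_ : (fun z => _) = (fun z => Re (f z) + Re (g z))).
    exact: measurable_funD.
  by apply/funext => z; case: (f z) (g z) => [a b] [c d].
- rewrite (_ : (fun z => _) = (fun z => Im (f z) + Im (g z))).
    exact: measurable_funD.
  by apply/funext => z; case: (f z) (g z) => [a b] [c d].
Qed.

Lemma L2pred_submod : submod_closed L2pred.
Proof.
have cst2 (k : R) (f : circle -> R[i]) : cmeasurable f ->
    (0 <= k)%R -> (\int[m]_z (cabs (f z) ^+ 2)%:E < +oo)%E ->
    (\int[m]_z (k * cabs (f z) ^+ 2)%:E < +oo)%E.
  move=> mf k0 h; under eq_integral do rewrite EFinM.
  rewrite ge0_integralZl//; last 2 first.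
  - exact: cmeasurable_cabs2.
  - by move=> z _; rewrite lee_fin sqr_ge0.
  by rewrite lte_mul_pinfty.
split.
  rewrite inE; split; first exact: (cmeasurable_cst 0).
  under eq_integral do rewrite cabs2/= expr0n addr0.
  by rewrite integral0.
move=> a f g; rewrite !inE => -[mf hf] [mg hg].
have maf : cmeasurable (fun z => a * f z).
  by apply: cmeasurableM => //; exact: cmeasurable_cst.
split; first exact: cmeasurableD.
have ma2 : (0 <= 2 * cabs a ^+ 2)%R by rewrite mulr_ge0 ?sqr_ge0.
apply: (@le_lt_trans _ _ (\int[m]_z ((2 * cabs a ^+ 2 * cabs (f z) ^+ 2)%:E
    + (2 * cabs (g z) ^+ 2)%:E))%E); last first.
  rewrite ge0_integralD//; first by rewrite lte_add_pinfty// cst2.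
  - by move=> z _; rewrite lee_fin mulr_ge0 ?sqr_ge0.
  - under eq_fun do rewrite EFinM.
    by apply: measurable_funeM; exact: cmeasurable_cabs2.
  - by move=> z _; rewrite lee_fin mulr_ge0 ?sqr_ge0.
  - under eq_fun do rewrite EFinM.
    by apply: measurable_funeM; exact: cmeasurable_cabs2.
apply: ge0_le_integral => //.
- by move=> z _; rewrite lee_fin sqr_ge0.
- by apply: cmeasurable_cabs2; exact: cmeasurableD.
- apply: emeasurable_funD; under eq_fun do rewrite EFinM;
    by apply: measurable_funeM; exact: cmeasurable_cabs2.
- move=> z _; rewrite -EFinD lee_fin.
  rewrite (_ : (a *: f + g) z = a * f z + g z :> R[i])// !cabs2 /=.
  case: a {ma2 maf} (f z) (g z) => [a b] [c d] [u v] /=.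
  rewrite -subr_ge0; set e := (X in 0 <= X).
  have -> : e = ((a * c - b * d) - u) ^+ 2 + ((a * d + b * c) - v) ^+ 2.
    by rewrite /e; ring.
  by rewrite addr_ge0// sqr_ge0.
Qed.

HB.instance Definition _ :=
  GRing.isSubmodClosed.Build R[i] cfun L2pred L2pred_submod.

Record L2fun := MkL2fun { L2fun_val :> cfun; _ : L2fun_val \in L2pred }.
HB.instance Definition _ := [isSub for L2fun_val].
HB.instance Definition _ := [Choice of L2fun by <:].
HB.instance Definition _ := [SubChoice_isSubLmodule of L2fun by <:].

Definition nullpred : {pred L2fun} :=
  [pred f : L2fun | `[< {ae m, forall z, f z = 0 :> R[i]} >]].

Lemma nullpred_zmod : zmod_closed nullpred.
Proof.
split; first by apply/asboolP; exact: aeW.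
move=> f g /asboolP f0 /asboolP g0; apply/asboolP.
by apply: filterS2 f0 g0 => z /= fz gz; rewrite [LHS](_ : _ = f z - g z)// fz gz subrr.
Qed.

Lemma nullpredZ (a : R[i]) (f : L2fun) : f \in nullpred -> a *: f \in nullpred.
Proof.
move=> /asboolP f0; apply/asboolP.
by apply: filterS f0 => z /= fz; rewrite [LHS](_ : _ = a * f z)// fz mulr0.
Qed.

HB.instance Definition _ :=
  GRing.isZmodClosed.Build L2fun nullpred nullpred_zmod.

Definition L2 : Type := Quotient.quot (nullpred : zmodClosed L2fun).

HB.instance Definition _ := Choice.on L2.
HB.instance Definition _ := EqQuotient.on L2.
HB.instance Definition _ := GRing.Zmodule.on L2.
HB.instance Definition _ := ZmodQuotient.on L2.

Definition L2class (f : L2fun) : L2 := (\pi_L2 f)%qT.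
Definition L2repr (f : L2) : L2fun := repr f.

Lemma L2reprK f : L2class (L2repr f) = f.
Proof. exact: reprK. Qed.

Lemma L2classD f g : L2class (f + g) = L2class f + L2class g.
Proof. exact: raddfD. Qed.

Lemma L2class_eqP (f g : L2fun) :
  L2class f = L2class g <-> {ae m, forall z, f z = g z}.
Proof.
rewrite /L2class; split.
  move/eqP; rewrite -Quotient.idealrBE => /asboolP.
  by apply: filterS => z /= /eqP; rewrite subr_eq0 => /eqP.
move=> fg; apply/eqP; rewrite -Quotient.idealrBE; apply/asboolP.
by apply: filterS fg => z /= e; rewrite [LHS](_ : _ = f z - g z)// e subrr.
Qed.

Lemma L2repr_class (f : L2fun) : {ae m, forall z, L2repr (L2class f) z = f z}.
Proof. by apply/L2class_eqP; rewrite L2reprK. Qed.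

Definition L2scale (a : R[i]) (f : L2) : L2 := L2class (a *: L2repr f).

Lemma L2scale_class a (f : L2fun) : L2scale a (L2class f) = L2class (a *: f).
Proof.
apply/L2class_eqP; apply: filterS (L2repr_class f) => z /= e.
by congr (a * _).
Qed.

Fact L2scaleA a b f : L2scale a (L2scale b f) = L2scale (a * b) f.
Proof. by rewrite -[f]L2reprK !L2scale_class scalerA. Qed.

Fact L2scale1 : left_id 1 L2scale.
Proof. by move=> f; rewrite -[f]L2reprK L2scale_class scale1r. Qed.

Fact L2scaleDr : right_distributive L2scale +%R.
Proof.
move=> a f g; rewrite -[f]L2reprK -[g]L2reprK -L2classD !L2scale_class.
by rewrite scalerDr L2classD.
Qed.

Fact L2scaleDl f : {morph L2scale^~ f : a b / a + b}.
Proof.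
by move=> a b; rewrite -[f]L2reprK !L2scale_class scalerDl L2classD.
Qed.

HB.instance Definition _ := GRing.Zmodule_isLmodule.Build R[i] L2
  L2scaleA L2scale1 L2scaleDr L2scaleDl.

(* The class of f, with junk value 0 if f is not square integrable. *)
Definition toL2 (f : circle -> R[i]) : L2 := L2class (insubd 0 (f : cfun)).

Lemma toL2E (f : circle -> R[i]) (h : (f : cfun) \in L2pred) :
  toL2 f = L2class (MkL2fun h).
Proof. by congr L2class; apply: val_inj; rewrite insubdK. Qed.

Definition L2dot (f g : L2) : R[i] :=
  cintegral (fun z => L2repr f z * (L2repr g z : R[i])^*).

Definition L2norm (f : L2) : R :=
  Num.sqrt (\int[m]_z (cabs (L2repr f z) ^+ 2))%R.

Definition fourier (f : L2) (n : int) : R[i] :=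
  cintegral (fun z => L2repr f z * ((z : R[i]) ^ n)^*).

Definition H2 : set L2 :=
  [set f | forall n : int, (n < 0)%R -> fourier f n = 0].

Definition orth (V : set L2) : set L2 :=
  [set g | forall f, V f -> L2dot f g = 0].

Definition H2perp : set L2 := orth H2.

(* The point g of V with f - g orthogonal to V, which exists and is unique when
   V is a closed subspace. *)
Definition orth_proj (V : set L2) (f : L2) : L2 :=
  xget 0 [set g | V g /\ orth V (f - g)].

Definition projH2 (f : L2) : L2 := orth_proj H2 f.
Definition projH2perp (f : L2) : L2 := f - projH2 f.

Definition Linfty : set (circle -> R[i]) :=
  [set a | cmeasurable a /\ exists M : R, {ae m, forall z, cabs (a z) <= M}].

Definition analytic (f : L2) : Prop := H2 f.
Definition L2conj (f : L2) : L2 := toL2 (fun z => (L2repr f z : R[i])^*).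
Definition coanalytic (f : L2) : Prop := analytic (L2conj f).

Definition L2mul (a : circle -> R[i]) (f : L2) : L2 :=
  toL2 (fun z => a z * L2repr f z).

Definition Sop (a b : circle -> R[i]) (f : L2) : L2 :=
  L2mul a (projH2 f) + L2mul b (projH2perp f).

Definition bounded_operator (T : L2 -> L2) : Prop :=
  exists C : R, forall f, L2norm (T f) <= C * L2norm f.

(* The lemmas below show that toL2 does not return its junk value in L2conj, nor
   in L2mul a f and toL2 a for a in Linfty. *)
Lemma cmeasurable_conj f : cmeasurable f -> cmeasurable (fun z => (f z)^*).
Proof.
move=> [fr fi]; split.
  rewrite (_ : (fun z => _) = (fun z => Re (f z)))//.
  by apply/funext => z; case: (f z).
rewrite (_ : (fun z => _) = (fun z => - Im (f z))); first exact: measurable_funN.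
by apply/funext => z; case: (f z).
Qed.

Lemma L2pred_conj (f : circle -> R[i]) :
  (f : cfun) \in L2pred -> ((fun z => (f z)^*) : cfun) \in L2pred.
Proof.
rewrite !inE => -[mf hf]; split; first exact: cmeasurable_conj.
rewrite (_ : (fun z => _) = (fun z => (cabs (f z) ^+ 2)%:E))//.
by apply/funext => z; rewrite !cabs2; case: (f z) => a b /=; rewrite sqrrN.
Qed.

Lemma L2pred_mul (a f : circle -> R[i]) : Linfty a ->
  (f : cfun) \in L2pred -> ((fun z => a z * f z) : cfun) \in L2pred.
Proof.
move=> [ma [M aM]]; rewrite !inE => -[mf hf].
split; first exact: cmeasurableM.
apply: (@le_lt_trans _ _ (\int[m]_z ((M ^+ 2)%:E * (cabs (f z) ^+ 2)%:E))%E).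
  apply: ae_ge0_le_integral => //.
  - by move=> z _; rewrite lee_fin sqr_ge0.
  - exact: (cmeasurable_cabs2 (cmeasurableM ma mf)).
  - by move=> z _; rewrite -EFinM lee_fin mulr_ge0 ?sqr_ge0.
  - by apply: measurable_funeM; exact: cmeasurable_cabs2.
  - apply: filterS aM => z /= azM _; rewrite -EFinM lee_fin.
    rewrite /cabs ComplexField.Normc.normcM exprMn ler_wpM2r ?sqr_ge0//.
    by rewrite lerXn2r// ?nnegrE ?cabs_ge0// (le_trans _ azM) ?cabs_ge0.
rewrite ge0_integralZl//.
- by rewrite lte_mul_pinfty// lee_fin sqr_ge0.
- exact: cmeasurable_cabs2.
- by move=> z _; rewrite lee_fin sqr_ge0.
- by rewrite lee_fin sqr_ge0.
Qed.

Lemma L2pred1 : ((fun=> 1) : cfun) \in L2pred.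
Proof.
rewrite inE; split; first exact: (cmeasurable_cst 1).
under eq_integral do rewrite cabs2/= expr1n expr0n/= addr0.
rewrite integral_cst// mul1e.
by rewrite (le_lt_trans (probability_le1 m measurableT))// ltry.
Qed.

Lemma Linfty_L2pred (a : circle -> R[i]) :
  Linfty a -> (a : cfun) \in L2pred.
Proof.
move=> /L2pred_mul /(_ L2pred1).
by under [X in X \in _ -> _]eq_fun do rewrite mulr1.
Qed.

Lemma Linfty_zfun : Linfty (zfun (R := R)).
Proof.
have mpair : measurable_fun setT (@circle_pair R).
  by move=> _ A mA; exists A.
split.
- by split; [have := measurableT_comp measurable_fst mpair
            |have := measurableT_comp measurable_snd mpair].
- by exists 1; apply: aeW => z; rewrite /zfun; case: z => c /= /eqP ->.
Qed.

Lemma Linfty_zbarfun : Linfty (zbarfun (R := R)).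
Proof.
have [mz _] := Linfty_zfun; split; first exact: cmeasurable_conj mz.
exists 1; apply: aeW => -[[a b] /= /eqP]; rewrite /zbarfun/cabs/= => h.
by rewrite sqrrN h.
Qed.
End L2.

Arguments Linfty {R}.
Arguments H2 {R}.
Arguments H2perp {R}.

(* Main.v *)
(* On H^2 the operator U = S_(z, zbar) is multiplication by z.  Split f in H^2 as
   f = f^(0) + U f1, so that T f = f^(0) T 1 + U T f1, and note that U sends the
   coefficient of index -k to index -k-1 and annihilates index -1.  If T maps one
   nonzero f in H^2 into H^2, one may divide by U until f^(0) <> 0; then the
   coefficient of index -1 of T 1, hence of every T g with g in H^2, vanishes, and
   by induction so do those of index -2, -3, ...: T preserves H^2.
   There T commutes with multiplication by z, so T f = alpha f for alpha = T 1, by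
   density of polynomials and uniqueness of Fourier coefficients in L^1.  Iterating,
   alpha^n = T^n 1, so the L^2 norm of alpha^n is at most |T|^n and alpha is
   essentially bounded.  The conjugate-linear involution J f = zbar (conj f)
   exchanges H^2 and its complement and commutes with U, so the statement on the
   complement follows by applying this to J T J. *)

Require Import Defs.
From mathcomp Require Import all_boot all_order all_algebra.
From mathcomp Require Import all_classical all_reals all_analysis.
From mathcomp Require Import measurable_realfun complex.
From mathcomp Require Import ring lra zify.

Set Implicit Arguments.
Unset Strict Implicit.
Unset Printing Implicit Defensive.

Import Order.TTheory GRing.Theory Num.Theory.
Import numFieldNormedType.Exports.

Local Open Scope classical_set_scope.
Local Open Scope ring_scope.
Local Open Scope complex_scope.

Local Notation Re := complex.Re.
Local Notation Im := complex.Im.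
(* Num.conj, which the notation denotes by default in ring_scope, is convertible
   to conjc on R[i] but blocks rewriting. *)
Local Notation "x ^*" := (conjc x) : ring_scope.

(** * Integration of complex functions *)

Section ComplexIntegral.
Variable R : realType.
Local Notation circle := (circle R).
Local Notation m := (circle_measure R).
Implicit Types (f g : circle -> R[i]) (c : R[i]).

(** Two obstacles account for most of the analysis. [orth_proj] is a choice with default value 0, so
    nothing can be said about [projH2] before L^2 is shown to split into [H2] and [H2perp]; the
    component in [H2] is built by Riesz-Fischer from the coefficients of nonnegative index. And as
    long as [alpha] is only known to lie in L^2, alpha f lies only in L^1, which is why Fourier
    uniqueness is proved for integrable functions: T f = alpha f has to come before the bound on
    [alpha], since that bound rests on alpha^n = T^n 1. Extensions from monomials to all of [H2] go
    through [H2_functional_eq0]: a bounded linear functional that vanishes at every z^k with k >= 0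
    vanishes on [H2]. Single Fourier coefficients supply such functionals. *)

Definition cintegrable f :=
  m.-integrable setT (EFin \o (fun z => Re (f z))) /\
  m.-integrable setT (EFin \o (fun z => Im (f z))).

Lemma complex_ReM (x y : R[i]) : Re (x * y) = Re x * Re y - Im x * Im y.
Proof. by case: x y => [a b] [d e]. Qed.

Lemma complex_ReD (x y : R[i]) : Re (x + y) = Re x + Re y.
Proof. exact: raddfD. Qed.

Lemma complex_ReC (x : R) : Re x%:C = x. Proof. by []. Qed.

Lemma complex_ImM (x y : R[i]) : Im (x * y) = Re x * Im y + Im x * Re y.
Proof. by case: x y => [a b] [d e]. Qed.

Lemma Re_conj (x : R[i]) : Re x^* = Re x. Proof. by case: x. Qed.

Lemma Im_conj (x : R[i]) : Im x^* = - Im x. Proof. by case: x. Qed.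

Lemma complex_eta (x : R[i]) : Re x +i* Im x = x. Proof. by case: x. Qed.

Lemma cabsM (x y : R[i]) : cabs (x * y) = cabs x * cabs y.
Proof. exact: ComplexField.Normc.normcM. Qed.

Lemma Re_le_cabs (x : R[i]) : `|Re x| <= cabs x.
Proof.
by rewrite -ler_sqr ?nnegrE ?cabs_ge0// cabs2 real_normK ?num_real// lerDl sqr_ge0.
Qed.

Lemma Im_le_cabs (x : R[i]) : `|Im x| <= cabs x.
Proof.
by rewrite -ler_sqr ?nnegrE ?cabs_ge0// cabs2 real_normK ?num_real// lerDr sqr_ge0.
Qed.

Lemma cintegrable_measurable f : cintegrable f -> cmeasurable f.
Proof. by move=> [fr fi]; split; apply/measurable_EFinP/(measurable_int m). Qed.

Lemma eq_cintegral f g : f =1 g -> cintegral f = cintegral g.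
Proof. by move=> fg; congr cintegral; apply/funext. Qed.

Lemma cintegrableD f g : cintegrable f -> cintegrable g ->
  cintegrable (fun z => f z + g z).
Proof.
move=> [fr fi] [gr gi]; split.
  rewrite (_ : _ \o _ = (EFin \o (fun z => Re (f z))) \+ (EFin \o (fun z => Re (g z)))).
    exact: integrableD.
  by apply/funext => z /=; rewrite raddfD.
rewrite (_ : _ \o _ = (EFin \o (fun z => Im (f z))) \+ (EFin \o (fun z => Im (g z)))).
  exact: integrableD.
by apply/funext => z /=; rewrite raddfD.
Qed.

Lemma cintegralD f g : cintegrable f -> cintegrable g ->
  cintegral (fun z => f z + g z) = cintegral f + cintegral g.
Proof.
move=> [fr fi] [gr gi]; rewrite /cintegral; under eq_Rintegral do rewrite raddfD.
rewrite RintegralD//; under [X in _ +i* X]eq_Rintegral do rewrite raddfD.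
by rewrite RintegralD.
Qed.

Lemma integrable_rlincomb (u v : circle -> R) (a b : R) :
  m.-integrable setT (EFin \o u) -> m.-integrable setT (EFin \o v) ->
  m.-integrable setT (EFin \o (fun z => a * u z + b * v z)).
Proof.
move=> iu iv.
rewrite (_ : _ \o _ = (fun z => a%:E * (EFin \o u) z)%E \+ (fun z => b%:E * (EFin \o v) z)%E)//.
by apply: integrableD => //; apply: integrableZl.
Qed.

Lemma Rintegral_rlincomb (u v : circle -> R) (a b : R) :
  m.-integrable setT (EFin \o u) -> m.-integrable setT (EFin \o v) ->
  (\int[m]_z (a * u z + b * v z) = a * \int[m]_z u z + b * \int[m]_z v z)%R.
Proof.
move=> iu iv; rewrite RintegralD//; first by rewrite !RintegralZl.
  exact: (integrableZl measurableT a iu).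
exact: (integrableZl measurableT b iv).
Qed.

Lemma cintegrableZ c f : cintegrable f -> cintegrable (fun z => c * f z).
Proof.
move=> [fr fi]; split.
  rewrite (_ : (fun z => _) = (fun z => Re c * Re (f z) + (- Im c) * Im (f z))).
    exact: integrable_rlincomb.
  by apply/funext => z; rewrite complex_ReM mulNr.
rewrite (_ : (fun z => _) = (fun z => Re c * Im (f z) + (Im c) * Re (f z))).
  exact: integrable_rlincomb.
by apply/funext => z; rewrite complex_ImM.
Qed.

Lemma cintegralZ c f : cintegrable f ->
  cintegral (fun z => c * f z) = c * cintegral f.
Proof.
move=> [fr fi]; rewrite /cintegral.
under eq_Rintegral do rewrite complex_ReM -mulNr.
under [X in _ +i* X]eq_Rintegral do rewrite complex_ImM.
rewrite !Rintegral_rlincomb//.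
by case: c => a b; rewrite mulNr.
Qed.

Lemma cintegral_conj f : cintegrable f ->
  cintegral (fun z => (f z)^*) = (cintegral f)^*.
Proof.
move=> [fr fi]; rewrite /cintegral.
under eq_Rintegral do rewrite Re_conj.
under [X in _ +i* X]eq_Rintegral do rewrite Im_conj -mulN1r.
by rewrite RintegralZl// mulN1r.
Qed.

Lemma ae_eq_cintegral f g : cmeasurable f -> cmeasurable g ->
  {ae m, forall z, f z = g z} -> cintegral f = cintegral g.
Proof.
move=> [fr fi] [gr gi] fg; congr (_ +i* _); congr fine.
  apply: ae_eq_integral => //; [exact/measurable_EFinP..|].
  by apply: filterS fg => z /= ->.
apply: ae_eq_integral => //; [exact/measurable_EFinP..|].
by apply: filterS fg => z /= ->.
Qed.

Lemma measurable_cabs f : cmeasurable f -> measurable_fun setT (fun z => cabs (f z)).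
Proof.
move=> mf; rewrite (_ : (fun z => _) = (fun z => Num.sqrt (cabs (f z) ^+ 2))).
  have m2 := (measurable_EFinP _ _).1 (cmeasurable_cabs2 mf).
  exact: (measurableT_comp (continuous_measurable_fun (@sqrt_continuous R)) m2).
by apply/funext => z; rewrite sqrtr_sqr ger0_norm// cabs_ge0.
Qed.

Lemma le_cintegrable f (h : circle -> R) : cmeasurable f ->
  m.-integrable setT (EFin \o h) -> (forall z, cabs (f z) <= h z) -> cintegrable f.
Proof.
move=> [fr fi] ih fh; split.
  apply: (le_integrable _ _ _ ih) => //; first exact/measurable_EFinP.
  move=> z _ /=; rewrite lee_fin (le_trans (Re_le_cabs _))// (le_trans (fh z))//.
  exact: ler_norm.
apply: (le_integrable _ _ _ ih) => //; first exact/measurable_EFinP.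
move=> z _ /=; rewrite lee_fin (le_trans (Im_le_cabs _))// (le_trans (fh z))//.
exact: ler_norm.
Qed.

Lemma cabs_le (x : R[i]) : cabs x <= `|Re x| + `|Im x|.
Proof.
rewrite -ler_sqr ?nnegrE ?cabs_ge0 ?addr_ge0// cabs2 sqrrD !real_normK ?num_real//.
by rewrite addrAC lerDl mulrn_wge0// mulr_ge0.
Qed.

Lemma integrable_cabs f : cintegrable f ->
  m.-integrable setT (EFin \o (fun z => cabs (f z))).
Proof.
move=> ifc; have mf := cintegrable_measurable ifc; case: ifc => fr fi.
have := integrableD measurableT (integrable_norm fr) (integrable_norm fi).
apply: le_integrable => //; first by apply/measurable_EFinP; exact: measurable_cabs.
move=> z _ /=; rewrite lee_fin ger0_norm ?cabs_ge0// (le_trans (cabs_le _))//.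
exact: ler_norm.
Qed.

Lemma cintegrable_bounded f g (M : R) : cintegrable f -> cmeasurable g ->
  (forall z, cabs (g z) <= M) -> cintegrable (fun z => f z * g z).
Proof.
move=> ifc mg gM; have mf := cintegrable_measurable ifc.
(* The zero second term gives the majorant the shape handled by [integrable_rlincomb]. *)
apply: (@le_cintegrable _ (fun z => M * cabs (f z) + 0 * cabs (f z))).
- exact: cmeasurableM.
- by apply: integrable_rlincomb; exact: integrable_cabs.
- by move=> z; rewrite cabsM mul0r addr0 mulrC ler_wpM2r// cabs_ge0.
Qed.

Lemma cintegrable_cst c : cintegrable (fun=> c).
Proof. by split; exact: finite_measure_integrable_cst. Qed.

End ComplexIntegral.

(** * Uniqueness of Fourier coefficients in L^1 *)

Lemma bernoulli_inequality (R : realDomainType) (x : R) n :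
  -1 <= x -> 1 + x *+ n <= (1 + x) ^+ n.
Proof.
move=> x1; elim: n => [|n ih]; first by rewrite mulr0n addr0 expr0.
have x2 : 0 <= x ^+ 2 *+ n by rewrite mulrn_wge0 ?sqr_ge0.
apply: le_trans (_ : (1 + x) * (1 + x *+ n) <= _); last first.
  by rewrite exprS ler_wpM2l// -lerBlDl sub0r.
rewrite expr2 -mulrnAr in x2.
by rewrite mulrS; lra.
Qed.

(** With s = (1 + r) / 2 one has r <= s^2, hence n r^n <= (n s^n) s^n. Bernoulli for 1/s = 1 + d
    bounds n s^n by 1/d, and the remaining factor s^n tends to 0. *)
Lemma cvg_natM_expr (R : realType) (r : R) : 0 <= r < 1 ->
  (n%:R * r ^+ n) @[n --> \oo] --> 0.
Proof.
move=> /andP[r0 r1]; pose s := (1 + r) / 2.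
have s0 : 0 < s by rewrite /s; lra.
have s1 : s < 1 by rewrite /s; lra.
have rs : r <= s ^+ 2.
  have := sqr_ge0 (1 - r); rewrite /s expr_div_n !expr2; lra.
pose d := s^-1 - 1.
have d0 : 0 < d by rewrite subr_gt0 invf_gt1.
have ns n : n%:R * s ^+ n <= d^-1.
  rewrite -ler_pdivlMr ?exprn_gt0// -exprVn -ler_pdivrMl ?invr_gt0// invrK.
  have := @bernoulli_inequality _ d n.
  rewrite (_ : 1 + d = s^-1); last by rewrite /d; ring.
  rewrite -mulr_natr => h; apply: le_trans (h _); lra.
apply: (@squeeze_cvgr _ _ _ _ (fun=> 0) (fun n => d^-1 * s ^+ n)).
- near=> n; rewrite mulr_ge0 ?exprn_ge0//=.
  apply: (@le_trans _ _ (n%:R * (s ^+ 2) ^+ n)).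
    by rewrite ler_wpM2l// lerXn2r// nnegrE// sqr_ge0.
  by rewrite -exprM mulnC exprM expr2 mulrA ler_wpM2r// exprn_ge0// ltW.
- exact: cvg_cst.
- rewrite -[X in _ --> X](mulr0 d^-1); apply: cvgMr.
  by apply: cvg_expr; rewrite ger0_norm// ltW.
Unshelve. all: by end_near. Qed.

(* The exponent n 2^n, rather than 2^n, makes the limit at t = 1/2 equal to 0. *)
Lemma cvg_threshold (R : realType) (t : R) : 0 <= t <= 1 ->
  ((1 - t ^+ n) ^+ (n * 2 ^ n)) @[n --> \oo] --> (((t < 2^-1)%R)%:R : R).
Proof.
move=> /andP[t0 t1].
have u0 n : 0 <= t ^+ n by rewrite exprn_ge0.
have u1 n : t ^+ n <= 1 by rewrite exprn_ile1.
have E n : t ^+ n *+ (n * 2 ^ n) = n%:R * (2 * t) ^+ n.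
  by rewrite -mulr_natr natrM natrX exprMn; ring.
have [th|th] := ltP t 2^-1.
  (* Bernoulli bounds the power below by 1 - n (2t)^n, where 2t < 1. *)
  apply: (@squeeze_cvgr _ _ _ _ (fun n => 1 - n%:R * (2 * t) ^+ n) (fun=> 1)).
  - near=> n; apply/andP; split.
      rewrite -E -mulNrn; apply: bernoulli_inequality.
      by rewrite lerN2.
    by rewrite exprn_ile1// ?subr_ge0// lerBlDr lerDl.
  - rewrite -[X in _ --> X]subr0; apply: cvgB; first exact: cvg_cst.
    apply: cvg_natM_expr; apply/andP; split; [by rewrite mulr_ge0|].
    by rewrite -ltr_pdivlMl// mulr1.
  - exact: cvg_cst.
(* Since (1 - t^n)(1 + t^n) <= 1, the k-th power of the first factor is at most the inverse of that
   of the second, and Bernoulli gives (1 + t^n)^k >= 1 + n (2t)^n >= n + 1. *)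
apply: (@squeeze_cvgr _ _ _ _ (fun=> 0) (@harmonic R)).
- near=> n; rewrite exprn_ge0 ?subr_ge0//=.
  set k := (n * 2 ^ n)%N.
  have h : n.+1%:R <= (1 + t ^+ n) ^+ k.
    apply: le_trans (bernoulli_inequality k _); last exact: le_trans (u0 n).
    rewrite E -natr1 addrC lerD2l ler_peMr// exprn_ege1//.
    by rewrite -ler_pdivrMl// mulr1.
  rewrite /harmonic -[leRHS]mul1r ler_pdivlMr ?ltr0n//.
  apply: (@le_trans _ _ ((1 - t ^+ n) ^+ k * (1 + t ^+ n) ^+ k)).
    by rewrite ler_wpM2l// exprn_ge0// subr_ge0.
  rewrite -exprMn exprn_ile1//.
    by rewrite mulr_ge0 ?subr_ge0// addr_ge0.
  rewrite (_ : _ * _ = 1 - (t ^+ n) ^+ 2); last by ring.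
  by rewrite lerBlDr lerDl sqr_ge0.
- exact: cvg_cst.
- exact: cvg_harmonic.
Unshelve. all: by end_near. Qed.

(** * Integer powers of z on the circle *)

Section Monomials.
Variable R : realType.
Local Notation circle := (circle R).
Implicit Types (f g : circle -> R[i]) (n : int) (z : circle).

Definition zpow n : circle -> R[i] := fun z => (z : R[i]) ^ n.

Lemma cabs_circle z : cabs (z : R[i]) = 1.
Proof. by case: z => w /= /eqP. Qed.

Lemma circle_neq0 z : (z : R[i]) != 0.
Proof.
apply/eqP => z0; have := cabs_circle z; rewrite z0 => /eqP.
by rewrite /cabs ComplexField.Normc.normc0 eq_sym oner_eq0.
Qed.

Lemma mulr_conj_circle z : (z : R[i]) * (z : R[i])^* = 1.
Proof.
have : cabs (z : R[i]) ^+ 2 = 1 by rewrite cabs_circle expr1n.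
rewrite cabs2; case: (z : R[i]) => a b /= h.
by apply/eqP; rewrite eq_complex /=; apply/andP; split; apply/eqP;
  [rewrite -h|]; ring.
Qed.

Lemma circle_conj z : (z : R[i])^* = (z : R[i])^-1.
Proof.
by apply: (mulfI (circle_neq0 z)); rewrite mulr_conj_circle mulfV ?circle_neq0.
Qed.

Lemma conj_zpow n z : (zpow n z)^* = zpow (- n) z.
Proof.
rewrite /zpow -exprz_inv -circle_conj.
by rewrite (fmorphXz (@conjc R)).
Qed.

Lemma zpowD n k z : zpow (n + k) z = zpow n z * zpow k z.
Proof. by rewrite /zpow expfzDr// circle_neq0. Qed.

Lemma zpow0 z : zpow 0 z = 1. Proof. by []. Qed.

Lemma zpow1 z : zpow 1 z = z. Proof. by rewrite /zpow expr1z. Qed.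

Lemma zpowN1 z : zpow (-1) z = (z : R[i])^*.
Proof. by rewrite -conj_zpow zpow1. Qed.

Lemma cabs_conj (x : R[i]) : cabs x^* = cabs x.
Proof. by case: x => a b; rewrite /cabs /= sqrrN. Qed.

Lemma cabs1 : cabs (1 : R[i]) = 1.
Proof. exact: ComplexField.Normc.normc1. Qed.

Lemma cabs_zpow n z : cabs (zpow n z) = 1.
Proof.
have pos (k : nat) : cabs (zpow k z) = 1.
  elim: k => [|k ih]; first by rewrite zpow0 cabs1.
  by rewrite intS zpowD cabsM ih zpow1 cabs_circle mulr1.
case: n => k; first exact: pos.
by rewrite NegzE -conj_zpow cabs_conj pos.
Qed.

Lemma cmeasurable_zpow n : cmeasurable (zpow n).
Proof.
have pos (k : nat) : cmeasurable (zpow k).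
  elim: k => [|k ih]; first exact: (cmeasurable_cst 1).
  rewrite (_ : zpow _ = fun z => zpow 1 z * zpow k z).
    apply: cmeasurableM => //.
    by rewrite (_ : zpow 1 = @zfun R); [case: (Linfty_zfun R)|apply/funext => z; rewrite zpow1].
  by apply/funext => z; rewrite intS zpowD.
case: n => k; first exact: pos.
rewrite (_ : zpow _ = fun z => (zpow k.+1 z)^*); first exact/cmeasurable_conj.
by apply/funext => z; rewrite NegzE conj_zpow.
Qed.

Lemma cintegrable_zpow f n : cintegrable f -> cintegrable (fun z => f z * zpow n z).
Proof.
move=> fi; apply: (cintegrable_bounded fi (cmeasurable_zpow n) (M := 1)) => z.
by rewrite cabs_zpow.
Qed.

End Monomials.

Section FourierUniqueness.
Variable R : realType.
Local Notation circle := (circle R).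
Local Notation m := (circle_measure R).
Implicit Types (f g : circle -> R[i]) (z : circle) (u : circle -> R).

Definition zero_fourier g :=
  cintegrable g /\ forall n, cintegral (fun z => g z * zpow n z) = 0.

(* The bounded multipliers form an algebra closed under bounded pointwise limits
   and containing the coordinates Re and Im, hence every indicator function. *)
Definition multiplier u :=
  [/\ measurable_fun setT u, exists M, forall z, `|u z| <= M &
      forall g, zero_fourier g -> zero_fourier (fun z => g z * (u z)%:C)].

Lemma cabs_real (x : R) : cabs x%:C = `|x|.
Proof. by rewrite /cabs /= expr0n addr0 sqrtr_sqr. Qed.

Lemma cmeasurable_real u : measurable_fun setT u -> cmeasurable (fun z => (u z)%:C).
Proof. by move=> mu; split => //=; exact: measurable_cst. Qed.

Lemma zero_fourierD f g : zero_fourier f -> zero_fourier g ->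
  zero_fourier (fun z => f z + g z).
Proof.
move=> [fi f0] [gi g0]; split; first exact: cintegrableD.
move=> n; under eq_cintegral do rewrite mulrDl.
by rewrite cintegralD ?f0 ?g0 ?addr0//; exact: cintegrable_zpow.
Qed.

Lemma zero_fourierZ c f : zero_fourier f -> zero_fourier (fun z => c * f z).
Proof.
move=> [fi f0]; split; first exact: cintegrableZ.
move=> n; under eq_cintegral do rewrite -mulrA.
by rewrite cintegralZ ?f0 ?mulr0//; exact: cintegrable_zpow.
Qed.

Lemma zero_fourier_zpow k f : zero_fourier f -> zero_fourier (fun z => f z * zpow k z).
Proof.
move=> [fi f0]; split; first exact: cintegrable_zpow.
by move=> n; under eq_cintegral do rewrite -mulrA -zpowD.
Qed.

Lemma multiplierD u v : multiplier u -> multiplier v -> multiplier (fun z => u z + v z).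
Proof.
move=> [mu [M uM] hu] [mv [N vN] hv]; split.
- exact: measurable_funD.
- by exists (M + N) => z; rewrite (le_trans (ler_normD _ _))// lerD.
- move=> g g0; have := zero_fourierD (hu _ g0) (hv _ g0).
  by under eq_fun do rewrite -mulrDr -rmorphD.
Qed.

Lemma multiplierM u v : multiplier u -> multiplier v -> multiplier (fun z => u z * v z).
Proof.
move=> [mu [M uM] hu] [mv [N vN] hv]; split.
- exact: measurable_funM.
- by exists (M * N) => z; rewrite normrM ler_pM.
- move=> g g0; have := (hv _ (hu _ g0)).
  by under eq_fun do rewrite -mulrA -rmorphM.
Qed.

Lemma multiplier_cst (c : R) : multiplier (fun=> c).
Proof.
split; [exact: measurable_cst|by exists (`|c|)|].
by move=> g g0; have := zero_fourierZ c%:C g0; under eq_fun do rewrite mulrC.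
Qed.

Lemma multiplierX u (n : nat) : multiplier u -> multiplier (fun z => u z ^+ n).
Proof.
move=> hu; elim: n => [|n ih]; first exact: (multiplier_cst 1).
by under eq_fun do rewrite exprS; exact: multiplierM.
Qed.

Lemma multiplierB u v : multiplier u -> multiplier v -> multiplier (fun z => u z - v z).
Proof.
move=> hu hv; have := multiplierD hu (multiplierM (multiplier_cst (-1)) hv).
by under eq_fun do rewrite mulN1r.
Qed.

Lemma circle_Re_le1 z : `|Re (z : R[i])| <= 1.
Proof. by rewrite (le_trans (Re_le_cabs _))// cabs_circle. Qed.

Lemma circle_Im_le1 z : `|Im (z : R[i])| <= 1.
Proof. by rewrite (le_trans (Im_le_cabs _))// cabs_circle. Qed.

(** On the circle Re z = (z + z^-1) / 2, and multiplication by a power of z only shifts the Fourier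
    coefficients. *)
Lemma multiplier_Re : multiplier (fun z => Re (z : R[i])).
Proof.
split; [by case: (Linfty_zfun R) => -[]|by exists 1; exact: circle_Re_le1|].
move=> g g0; have := zero_fourierZ 2^-1
  (zero_fourierD (zero_fourier_zpow 1 g0) (zero_fourier_zpow (-1) g0)).
rewrite (_ : (fun _ => _) = (fun z => g z * (Re (z : R[i]))%:C))//.
apply/funext => z; rewrite zpow1 zpowN1 -mulrDr mulrCA; congr (_ * _).
case: (z : R[i]) => a b; apply/eqP; rewrite -(inj_eq (mulfI (x := 2) _)) ?pnatr_eq0//.
rewrite mulrA mulfV ?pnatr_eq0// mul1r mulr_natl mulr2n eq_complex /=.
by apply/andP; split; apply/eqP; ring.
Qed.

Lemma multiplier_Im : multiplier (fun z => Im (z : R[i])).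
Proof.
split; [by case: (Linfty_zfun R) => -[]|by exists 1; exact: circle_Im_le1|].
(* The two scalars are 1/(2i) and -1/(2i). *)
move=> g g0; have := zero_fourierD
  (zero_fourierZ (0 +i* - 2^-1) (zero_fourier_zpow 1 g0))
  (zero_fourierZ (0 +i* 2^-1) (zero_fourier_zpow (-1) g0)).
rewrite (_ : (fun _ => _) = (fun z => g z * (Im (z : R[i]))%:C))//.
apply/funext => z; rewrite zpow1 zpowN1.
case: (z : R[i]) (g z) => a b [c d]; apply/eqP; rewrite eq_complex /=.
by apply/andP; split; apply/eqP; field.
Qed.

(** Dominated convergence, applied separately to the real and imaginary parts of g z^n; because the
    [u_ k] are bounded by 1, the absolute value of that part dominates. *)
Lemma multiplier_lim (u_ : nat -> circle -> R) u :
  (forall k, multiplier (u_ k)) -> (forall k z, `|u_ k z| <= 1) ->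
  (forall z, u_ k z @[k --> \oo] --> u z) -> multiplier u.
Proof.
move=> hu u1 cu.
have mu : measurable_fun setT u.
  by apply: (measurable_fun_cvg (h := u_)) => // n; case: (hu n).
have ub z : `|u z| <= 1.
  by apply: (cvgr_to_le (cvg_norm (cu z))); exact: nearW.
have dct (v : circle -> R) : m.-integrable setT (EFin \o v) ->
    (forall n, \int[m]_z (v z * u_ n z) = 0)%R -> (\int[m]_z (v z * u z) = 0)%R.
  move=> iv v0.
  have mv : measurable_fun setT v by apply/measurable_EFinP/(measurable_int m).
  have /= := @dominated_cvg _ _ _ m setT measurableT
    (fun n => EFin \o (fun z => v z * u_ n z)) (EFin \o (fun z => v z * u z))
    (fun z => `|(v z)%:E|%E).
  have -> : (fun n => \int[m]_z (v z * u_ n z)%:E)%E = (fun=> 0%E).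
    apply/funext => n; rewrite -[LHS]fineK; first by rewrite [fine _](v0 n).
    apply: integrable_fin_num => //; apply: (le_integrable _ _ _ iv) => //.
      by apply/measurable_EFinP/measurable_funM => //; case: (hu n).
    by move=> z _ /=; rewrite lee_fin normrM ler_piMr.
  move=> h; have {h} : (fun=> 0%E : \bar R) @ \oo --> (\int[m]_z (v z * u z)%:E)%E.
    apply: h => //.
    - by move=> n; apply/measurable_EFinP/measurable_funM => //; case: (hu n).
    - move=> z _; apply: cvg_EFin; first exact: nearW.
      by apply: cvgMr; exact: cu.
    - exact: (integrable_abse iv).
    - by move=> n z _; rewrite lee_fin normrM ler_piMr.
  move=> /(cvg_unique (@ereal_hausdorff R) (cvg_cst 0%E)).
  by rewrite /Rintegral => <-.
split => //; first by exists 1.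
move=> g g0; have [gi _] := g0.
have gui : cintegrable (fun z => g z * (u z)%:C).
  apply: (cintegrable_bounded (M := 1) gi (cmeasurable_real mu)) => z.
  by rewrite cabs_real.
split=> // n; have [ri ii] := cintegrable_zpow n gi.
rewrite [RHS](_ : 0 = 0 +i* 0)//; congr (_ +i* _).
  under eq_Rintegral do rewrite mulrAC complex_ReM mulr0 subr0.
  apply: dct => // k; have [_ _ /(_ _ g0)[_ /(_ n)[h _]]] := hu k.
  rewrite -[RHS]h; apply: eq_Rintegral => z _.
  by rewrite [in RHS]mulrAC [in RHS]complex_ReM mulr0 subr0.
under eq_Rintegral do rewrite mulrAC complex_ImM mulr0 add0r.
apply: dct => // k; have [_ _ /(_ _ g0)[_ /(_ n)[_ h]]] := hu k.
rewrite -[RHS]h; apply: eq_Rintegral => z _.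
by rewrite [in RHS]mulrAC [in RHS]complex_ImM mulr0 add0r.
Qed.

Lemma multiplier_halfspace u (a : R) : multiplier u -> (forall z, `|u z| <= 1) ->
  `|a| <= 1 -> multiplier (fun z => (u z < a)%R%:R).
Proof.
(* Since u - a lies in [-2, 2], this affine change of variable lands in [0, 1] and sends the
   threshold a to 1/2, where [cvg_threshold] supplies polynomials in t. *)
move=> hu u1 a1; pose t z := 2^-1 + 4^-1 * (u z - a).
have ht : multiplier t.
  apply: multiplierD; first exact: multiplier_cst.
  apply: multiplierM; first exact: multiplier_cst.
  by apply: multiplierB => //; exact: multiplier_cst.
have t01 z : 0 <= t z <= 1.
  by have := u1 z; move: a1; rewrite /t !ler_norml; lra.
apply: (@multiplier_lim (fun n z => (1 - t z ^+ n) ^+ (n * 2 ^ n))) => [n|n z|z].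
- apply: multiplierX; apply: multiplierB; first exact: multiplier_cst.
  exact: multiplierX.
- have /andP[t0 t1] := t01 z.
  have u01 : 0 <= 1 - t z ^+ n by rewrite subr_ge0 exprn_ile1.
  rewrite ger0_norm ?exprn_ge0// exprn_ile1//.
  by rewrite lerBlDr lerDl exprn_ge0.
- rewrite (_ : (u z < a) = (t z < 2^-1)); first exact: cvg_threshold.
  by rewrite /t; apply/idP/idP => h; lra.
Qed.

Definition multiplier_set (A : set circle) := multiplier \1_A.

Lemma multiplier_set_sigma_algebra : sigma_algebra setT multiplier_set.
Proof.
split.
- rewrite /multiplier_set indic0; exact: (multiplier_cst 0).
- move=> A hA; rewrite /multiplier_set setTD.
  rewrite (_ : \1__ = fun z => 1 - \1_A z); last first.
    by apply/funext => z; rewrite !indicE in_setC; case: (z \in A); rewrite /= ?subrr ?subr0.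
  by apply: multiplierB => //; exact: multiplier_cst.
- move=> A hA.
  (* The complement of a finite union has the product of the 1 - 1_(A i) as indicator, so the sets
     need not be made disjoint. *)
  have hC n : multiplier (fun z => \prod_(i < n) (1 - \1_(A i) z)).
    elim: n => [|n ih].
      by under eq_fun do rewrite big_ord0; exact: (multiplier_cst 1).
    under eq_fun do rewrite big_ord_recr /=; apply: multiplierM => //.
    by apply: multiplierB; [exact: multiplier_cst|exact: hA].
  have p01 n z : 0 <= \prod_(i < n) (1 - \1_(A i) z : R) <= 1.
    apply/andP; split.
      by apply: prodr_ge0 => i _; rewrite subr_ge0 indicE; case: (_ \in _).
    by apply: prodr_ile1 => i _; rewrite indicE; case: (_ \in _);
      rewrite /= ?subrr ?subr0 ?lexx ?ler01.
  apply: (@multiplier_lim (fun n z => 1 - \prod_(i < n) (1 - \1_(A i) z))) => [n|n z|z].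
  + by apply: multiplierB => //; exact: multiplier_cst.
  + by have /andP[p0 p1] := p01 n z; rewrite ger0_norm ?subr_ge0// lerBlDr lerDl.
  (* At a point of the union one factor eventually occurs that is 0; elsewhere every factor is 1. *)
  + apply: cvg_near_cst; rewrite indicE.
    have [/set_mem[k _ Akz]|] := boolP (z \in \bigcup_k A k).
      exists k.+1 => // n /= kn; rewrite (bigD1 (Ordinal kn)) //= indicE mem_set//.
      by rewrite subrr mul0r subr0.
    rewrite notin_setE => nA; apply: nearW => n; rewrite big1 ?subrr// => i _.
    rewrite indicE memNset ?subr0// => Ai; apply: nA; by exists i.
Qed.

(** The sets B with the required preimage form a sigma-algebra, so it is enough to treat the open
    half-lines, which generate the Borel sets. *)
Lemma multiplier_set_coord u : multiplier u -> (forall z, `|u z| <= 1) ->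
  forall B, measurable B -> multiplier_set (u @^-1` B).
Proof.
move=> hu u1 B mB.
pose G := [set B : set R | multiplier_set (u @^-1` B)].
have [s0 sC sU] := multiplier_set_sigma_algebra.
have sG : sigma_algebra setT G.
  split.
  - by rewrite /G /= preimage_set0.
  - by move=> A hA; rewrite /G /= setTD preimage_setC -setTD; exact: sC.
  - by move=> A hA; rewrite /G /= preimage_bigcup; exact: sU.
suff GG : measurable `<=` G by exact: GG.
rewrite [measurable](RGenInftyO.measurableE R); apply: smallest_sub => // _ [a ->].
rewrite /G /= /multiplier_set.
rewrite (_ : \1__ = fun z => (u z < a)%R%:R); last first.
  by apply/funext => z; rewrite indicE; congr ((nat_of_bool _)%:R);
    apply/idP/idP; rewrite inE /= in_itv.
(* For a outside [-1, 1] the half-line contains either all values of [u] or none. *)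
have [a1|] := leP `|a| 1; first exact: multiplier_halfspace.
rewrite ltNge ler_norml negb_and -!ltNge => /orP[a1|a1].
  rewrite (_ : (fun _ => _) = fun=> 0); first exact: multiplier_cst.
  apply/funext => z; rewrite ltNge (le_trans (ltW a1))//.
  by have := u1 z; rewrite ler_norml => /andP[].
rewrite (_ : (fun _ => _) = fun=> 1); first exact: multiplier_cst.
apply/funext => z; rewrite (le_lt_trans _ a1)//.
by have := u1 z; rewrite ler_norml => /andP[].
Qed.

(** Measurable sets of the circle are pulled back from R * R, whose sigma-algebra is generated by
    preimages under the two projections; hence the two coordinates suffice. *)
Lemma measurable_multiplier_set (A : set circle) : measurable A -> multiplier_set A.
Proof.
move=> [B mB <-]; rewrite setTI.
have [s0 sC sU] := multiplier_set_sigma_algebra.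
pose G := [set B : set (R * R) | multiplier_set (@circle_pair R @^-1` B)].
have sG : sigma_algebra setT G.
  split.
  - by rewrite /G /= preimage_set0.
  - by move=> D hD; rewrite /G /= setTD preimage_setC -setTD; exact: sC.
  - by move=> D hD; rewrite /G /= preimage_bigcup; exact: sU.
suff GG : measurable `<=` G by exact: GG.
apply: smallest_sub => // _ [|] [D mD <-]; rewrite /G /= setTI.
  exact: (multiplier_set_coord multiplier_Re circle_Re_le1).
exact: (multiplier_set_coord multiplier_Im circle_Im_le1).
Qed.

(** Multiplying [g] by the indicator of A keeps all coefficients zero, and the coefficient of index
    0 is then the integral of [g] over A. A function whose integrals over all measurable sets vanish
    is null. *)
Lemma zero_fourier_ae0 g : zero_fourier g -> {ae m, forall z, g z = 0}.
Proof.
move=> g0; have [[ri ii] _] := g0.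
have int0 A : measurable A -> cintegral (fun z => g z * (\1_A z)%:C) = 0.
  move=> mA; have [_ _ /(_ _ g0)[_ /(_ 0)]] := measurable_multiplier_set mA.
  by under eq_cintegral do rewrite zpow0 mulr1.
have ind (v : circle -> R) A : measurable A -> m.-integrable setT (EFin \o v) ->
    (\int[m]_z (v z * \1_A z) = 0)%R -> (\int[m]_(z in A) (v z)%:E = 0)%E.
  move=> mA iv v0.
  suff -> : (\int[m]_(z in A) (v z)%:E)%E = (\int[m]_z (v z * \1_A z))%R%:E by rewrite v0.
  rewrite -[LHS]fineK; last by apply: integrable_fin_num => //; exact: integrableS iv.
  congr EFin; rewrite -[LHS]/(\int[m]_(z in A) v z)%R Rintegral_mkcond.
  apply: eq_Rintegral => z _.
  by rewrite patchE indicE; case: (z \in A); rewrite ?mulr1 ?mulr0.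
have aeR : ae_eq m setT (EFin \o (fun z => Re (g z))) (cst 0%E).
  apply: integral_ae_eq => // A _ mA; rewrite integral0 ind//.
  have [h _] := int0 _ mA; rewrite -[RHS]h; apply: eq_Rintegral => z _.
  by rewrite complex_ReM mulr0 subr0.
have aeI : ae_eq m setT (EFin \o (fun z => Im (g z))) (cst 0%E).
  apply: integral_ae_eq => // A _ mA; rewrite integral0 ind//.
  have [_ h] := int0 _ mA; rewrite -[RHS]h; apply: eq_Rintegral => z _.
  by rewrite complex_ImM mulr0 add0r.
apply: filterS2 aeR aeI => z /= /(_ I)[r0] /(_ I)[i0].
by rewrite -(complex_eta (g z)) r0 i0.
Qed.

End FourierUniqueness.

(** * The inner product of L^2 *)

Section L2Dot.
Variable R : realType.
Local Notation circle := (circle R).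
Local Notation m := (circle_measure R).
Local Notation L2 := (L2 R).
Implicit Types (f g h : L2) (c : R[i]).

Lemma conjcD (x y : R[i]) : (x + y)^* = x^* + y^*.
Proof. exact: (rmorphD (@conjc R)). Qed.

Lemma conjcM (x y : R[i]) : (x * y)^* = x^* * y^*.
Proof. exact: (rmorphM (@conjc R)). Qed.

Lemma conjc_involutive (x : R[i]) : (x^*)^* = x.
Proof. by case: x => a b; rewrite /= opprK. Qed.

Lemma L2fun_L2pred (u : L2fun R) : (u : circle -> R[i]^o) \in @L2pred R.
Proof. by case: u. Qed.

Lemma L2fun_cmeasurable (u : L2fun R) : cmeasurable u.
Proof. by have := L2fun_L2pred u; rewrite inE => -[]. Qed.

Lemma L2_eqP f g :
  f = g <-> {ae m, forall z, L2repr f z = L2repr g z :> R[i]}.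
Proof. by rewrite -L2class_eqP !L2reprK. Qed.

Lemma L2repr_toL2 (F : circle -> R[i]) : (F : circle -> R[i]^o) \in @L2pred R ->
  {ae m, forall z, L2repr (toL2 F) z = F z :> R[i]}.
Proof. by move=> hF; rewrite (toL2E hF); exact: L2repr_class. Qed.

Lemma toL2_repr f : toL2 (L2repr f) = f.
Proof.
by apply/L2_eqP; apply: L2repr_toL2; exact: L2fun_L2pred.
Qed.

Lemma L2reprD f g :
  {ae m, forall z, L2repr (f + g) z = (L2repr f z : R[i]) + L2repr g z}.
Proof.
apply: filterS (L2repr_class (L2repr f + L2repr g)) => z.
by rewrite L2classD !L2reprK.
Qed.

Lemma L2reprZ c f : {ae m, forall z, L2repr (c *: f) z = c * L2repr f z}.
Proof. exact: L2repr_class. Qed.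

Lemma L2repr0 : {ae m, forall z, L2repr (0 : L2) z = 0 :> R[i]}.
Proof. by apply: filterS (L2reprZ 0 (0 : L2)) => z; rewrite scale0r mul0r. Qed.

Lemma L2repr_cmeasurable f : cmeasurable (L2repr f).
Proof. exact: L2fun_cmeasurable. Qed.

Lemma integrable_cabs2 (F : circle -> R[i]) : (F : circle -> R[i]^o) \in @L2pred R ->
  m.-integrable setT (EFin \o (fun z => cabs (F z) ^+ 2)).
Proof.
rewrite inE => -[mF hF]; apply/integrableP; split; first exact: cmeasurable_cabs2.
by under eq_integral do rewrite /= ger0_norm ?sqr_ge0//.
Qed.

Lemma cintegrable_L2M (F G : circle -> R[i]) :
  (F : circle -> R[i]^o) \in @L2pred R -> (G : circle -> R[i]^o) \in @L2pred R ->
  cintegrable (fun z => F z * G z).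
Proof.
move=> hF hG.
have mF : cmeasurable F by move: hF; rewrite inE => -[].
have mG : cmeasurable G by move: hG; rewrite inE => -[].
apply: (le_cintegrable (h := fun z => 1 * cabs (F z) ^+ 2 + 1 * cabs (G z) ^+ 2)).
- exact: cmeasurableM.
- by apply: integrable_rlincomb; exact: integrable_cabs2.
- move=> z; rewrite cabsM !mul1r; have := sqr_ge0 (cabs (F z) - cabs (G z)).
  have : 0 <= cabs (F z) * cabs (G z) by rewrite mulr_ge0 ?cabs_ge0.
  by rewrite sqrrB; lra.
Qed.

Lemma cintegrable_dot f g : cintegrable (fun z => L2repr f z * (L2repr g z : R[i])^*).
Proof.
by apply: cintegrable_L2M; [|apply: L2pred_conj]; exact: L2fun_L2pred.
Qed.

Lemma L2dotE f g :
  L2dot f g = cintegral (fun z => L2repr f z * (L2repr g z : R[i])^*).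
Proof. by []. Qed.

Lemma L2dotDl f g h : L2dot (f + g) h = L2dot f h + L2dot g h.
Proof.
rewrite !L2dotE -cintegralD; [|exact: cintegrable_dot..].
apply: ae_eq_cintegral.
- exact: cintegrable_measurable (cintegrable_dot _ _).
- by apply: cmeasurableD; exact: cintegrable_measurable (cintegrable_dot _ _).
- by apply: filterS (L2reprD f g) => z ->; rewrite mulrDl.
Qed.

Lemma L2dotZl c f g : L2dot (c *: f) g = c * L2dot f g.
Proof.
rewrite !L2dotE -cintegralZ; last exact: cintegrable_dot.
apply: ae_eq_cintegral.
- exact: cintegrable_measurable (cintegrable_dot _ _).
- apply: cmeasurableM; first exact: cmeasurable_cst.
  exact: cintegrable_measurable (cintegrable_dot _ _).
- by apply: filterS (L2reprZ c f) => z ->; rewrite mulrA.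
Qed.

Lemma L2dotC f g : L2dot g f = (L2dot f g)^*.
Proof.
rewrite !L2dotE -cintegral_conj; last exact: cintegrable_dot.
by apply: eq_cintegral => z; rewrite conjcM conjc_involutive mulrC.
Qed.

Lemma L2dotDr f g h : L2dot h (f + g) = L2dot h f + L2dot h g.
Proof. by rewrite L2dotC L2dotDl conjcD -!(L2dotC _ h). Qed.

Lemma L2dotZr c f g : L2dot g (c *: f) = c^* * L2dot g f.
Proof. by rewrite L2dotC L2dotZl conjcM -(L2dotC _ g). Qed.

Lemma L2dotNl f h : L2dot (- f) h = - L2dot f h.
Proof. by rewrite -scaleN1r L2dotZl mulN1r. Qed.

Lemma L2dotBl f g h : L2dot (f - g) h = L2dot f h - L2dot g h.
Proof. by rewrite L2dotDl L2dotNl. Qed.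

Lemma L2dot0l h : L2dot 0 h = 0.
Proof. by rewrite -(scale0r 0) L2dotZl mul0r. Qed.

Lemma L2dot_suml (I : Type) (s : seq I) (P : pred I) (F : I -> L2) h :
  L2dot (\sum_(i <- s | P i) F i) h = \sum_(i <- s | P i) L2dot (F i) h.
Proof. by elim/big_rec2: _ => [|i x y _ <-]; rewrite ?L2dot0l// L2dotDl. Qed.

Lemma L2norm_ge0 f : 0 <= L2norm f.
Proof. exact: sqrtr_ge0. Qed.

Lemma L2norm_sqr f : L2norm f ^+ 2 = (\int[m]_z (cabs (L2repr f z) ^+ 2))%R.
Proof. by rewrite /L2norm sqr_sqrtr//; apply: Rintegral_ge0 => z _; exact: sqr_ge0. Qed.

Lemma L2dot_norm f : L2dot f f = (L2norm f ^+ 2)%:C.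
Proof.
rewrite L2norm_sqr /L2dot /cintegral; congr (_ +i* _).
  apply: eq_Rintegral => z _; rewrite complex_ReM Re_conj Im_conj cabs2.
  by rewrite mulrN opprK -!expr2.
transitivity (\int[m]_z (0 : R))%R; last by rewrite Rintegral_cst// mul0r.
by apply: eq_Rintegral => z _; rewrite complex_ImM Re_conj Im_conj; ring.
Qed.

Lemma sqr_L2normD f g : L2norm (f + g) ^+ 2 =
  L2norm f ^+ 2 + L2norm g ^+ 2 + 2 * Re (L2dot f g).
Proof.
have /(congr1 (@complex.Re R)) := L2dot_norm (f + g).
rewrite L2dotDl !L2dotDr !L2dot_norm (L2dotC f g) !complex_ReD Re_conj !complex_ReC => <-.
by ring.
Qed.

Lemma sqr_L2normZ c f : L2norm (c *: f) ^+ 2 = cabs c ^+ 2 * L2norm f ^+ 2.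
Proof.
have /(congr1 (@complex.Re R)) := L2dot_norm (c *: f).
rewrite L2dotZl L2dotZr !L2dot_norm mulrA complex_ReM !complex_ReC mulr0 subr0 => <-.
by congr (_ * _); rewrite cabs2; case: c => a b /=; ring.
Qed.

Lemma cauchy_schwarz f g : cabs (L2dot f g) <= L2norm f * L2norm g.
Proof.
rewrite -ler_sqr ?nnegrE ?cabs_ge0 ?mulr_ge0 ?L2norm_ge0// exprMn.
set x := L2dot f g; set A := L2norm f ^+ 2; set B := L2norm g ^+ 2.
set X := cabs x ^+ 2.
have A0 : 0 <= A by exact: sqr_ge0.
have B0 : 0 <= B by exact: sqr_ge0.
have X0 : 0 <= X by exact: sqr_ge0.
(* This is the squared norm of f - t x g for real t; the factor x makes the cross term real. For B >
   0 the value t = 1/B minimises it. *)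
have key t : 0 <= A - 2 * t * X + t ^+ 2 * X * B.
  have := sqr_ge0 (L2norm (f + (- (t%:C * x)) *: g)).
  rewrite sqr_L2normD sqr_L2normZ L2dotZr -/A -/B -/x.
  rewrite (_ : cabs _ ^+ 2 = t ^+ 2 * X); last first.
    by rewrite /X !cabs2; case: (x) => a b /=; ring.
  rewrite (_ : Re _ = - (t * X)); last first.
    by rewrite /X !cabs2; case: (x) => a b /=; ring.
  by lra.
have [B1|B1] := ltP 0 B.
  have := key B^-1.
  rewrite (_ : _ + _ = A - X / B); last by field; rewrite gt_eqF.
  by rewrite subr_ge0 ler_pdivrMr.
have B00 : B = 0 by apply/le_anti; rewrite B0 B1.
rewrite B00 mulr0; rewrite leNgt; apply/negP => X1.
(* With B = 0 the expression is affine in t, and this t gives it the value -1. *)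
have := key ((A + 1) / (2 * X)); rewrite B00 mulr0 addr0.
rewrite (_ : _ - _ = -1); last by field; rewrite gt_eqF.
by rewrite ler0N1.
Qed.

Definition monomial (n : int) : L2 := toL2 (@zpow R n).

Lemma zpow_L2pred n : (@zpow R n : circle -> R[i]^o) \in @L2pred R.
Proof.
apply: Linfty_L2pred; split; first exact: cmeasurable_zpow.
by exists 1; apply: aeW => z; rewrite cabs_zpow.
Qed.

Lemma L2repr_monomial n : {ae m, forall z, L2repr (monomial n) z = zpow n z :> R[i]}.
Proof. exact/L2repr_toL2/zpow_L2pred. Qed.

Lemma cintegrable_fourier f n :
  cintegrable (fun z => L2repr f z * ((z : R[i]) ^ n)^*).
Proof.
by apply: cintegrable_L2M; [exact: L2fun_L2pred|apply/L2pred_conj/zpow_L2pred].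
Qed.

Lemma fourierE f n : fourier f n = L2dot f (monomial n).
Proof.
apply: ae_eq_cintegral.
- exact/cintegrable_measurable/cintegrable_fourier.
- exact/cintegrable_measurable/cintegrable_dot.
- by apply: filterS (L2repr_monomial n) => z ->.
Qed.

(** Allows the representative of a class, known only almost everywhere, to be replaced by an
    explicit integrand. *)
Lemma fourier_cintegral f n (F : circle -> R[i]) : cmeasurable F ->
  {ae m, forall z, L2repr f z * zpow (- n) z = F z} -> fourier f n = cintegral F.
Proof.
move=> mF fF; apply: ae_eq_cintegral => //.
  exact/cintegrable_measurable/cintegrable_fourier.
by apply: filterS fF => z <-; rewrite -conj_zpow.
Qed.

Lemma fourierD f g n : fourier (f + g) n = fourier f n + fourier g n.
Proof. by rewrite !fourierE L2dotDl. Qed.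

Lemma fourierZ c f n : fourier (c *: f) n = c * fourier f n.
Proof. by rewrite !fourierE L2dotZl. Qed.

Lemma fourierB f g n : fourier (f - g) n = fourier f n - fourier g n.
Proof. by rewrite !fourierE L2dotBl. Qed.

Lemma fourier0 n : fourier (0 : L2) n = 0.
Proof. by rewrite fourierE L2dot0l. Qed.

Lemma fourier_eq0 f : (forall n, fourier f n = 0) -> f = 0.
Proof.
move=> f0; have /zero_fourier_ae0 : zero_fourier (L2repr f : circle -> R[i]).
  have fi : cintegrable (L2repr f : circle -> R[i]).
    have := cintegrable_fourier f 0.
    by under eq_fun do rewrite (_ : _ ^ 0 = 1)// rmorph1 mulr1.
  split=> // n; rewrite -[RHS](f0 (- n)); symmetry.
  apply: fourier_cintegral; last by apply: aeW => z; rewrite opprK.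
  exact/cintegrable_measurable/cintegrable_zpow.
by move=> f00; apply/L2_eqP; apply: filterS2 f00 L2repr0 => z -> ->.
Qed.

Lemma fourier_inj f g : fourier f =1 fourier g -> f = g.
Proof.
move=> fg; apply/eqP; rewrite -subr_eq0; apply/eqP/fourier_eq0 => n.
by rewrite fourierB fg subrr.
Qed.

End L2Dot.

(** * Orthonormality of the monomials *)

Section Orthonormality.
Variable R : realType.
Local Notation circle := (circle R).
Local Notation m := (circle_measure R).
Implicit Types (n : int).

Lemma fine_circle_measureT : fine (m setT) = 1.
Proof. exact: (congr1 fine (probability_setT m)). Qed.

(* The mean of u is computed as that of 1 + u, which is nonnegative. *)
Lemma Rintegral_circle_deriv (u : circle -> R) (k F : R -> R) :
  measurable_fun setT u -> (forall z, `|u z| <= 1) ->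
  (forall t, u (expi t) = k t) -> continuous k ->
  (forall t : R, is_derive t (1:R) F (k t)) -> F (2 * pi) = F 0 ->
  (\int[m]_z u z = 0)%R.
Proof.
move=> mu u1 uk ck dF F0.
have iu : m.-integrable setT (EFin \o u).
  apply: (@le_integrable _ _ _ m setT measurableT _ (EFin \o cst 1)) => //.
  - exact/measurable_EFinP.
  - by move=> z _ /=; rewrite lee_fin normr1.
  - exact: finite_measure_integrable_cst.
have u0 z : 0 <= 1 + u z by have := u1 z; rewrite ler_norml; lra.
have pi0 := pi_gt0 R.
suff : (\int[m]_z (1 + u z))%R = 1.
  rewrite RintegralD//; last exact: finite_measure_integrable_cst.
  rewrite Rintegral_cst// fine_circle_measureT mulr1 => /eqP.
  by rewrite -subr_eq0 addrAC subrr add0r => /eqP.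
rewrite /Rintegral ge0_integral_distribution//; last first.
  by apply/measurable_EFinP; apply: measurable_funD.
rewrite [X in integral _ _ X](_ : _ = fun t => (1 + k t)%:E); last first.
  by apply/funext => t /=; rewrite uk.
have mk : measurable_fun setT (fun t => 1 + k t).
  by apply: measurable_funD => //; exact: continuous_measurable_fun.
rewrite integral_uniform//; last 2 first.
  exact/measurable_EFinP.
  by move=> t; rewrite lee_fin -uk.
have dG (t : R) : is_derive t 1 (fun t : R => t + F t) (1 + k t) by apply: is_deriveD.
have cG (t : R) : {for t, continuous (fun t : R => t + F t)}.
  by apply: differentiable_continuous; apply/derivable1_diffP; case: (dG t).
have c1k : {within `[0, 2 * pi], continuous (fun t : R => 1 + k t)}.
  by apply: continuous_subspaceT => t; apply: cvgD; [exact: cvg_cst|exact: ck].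
have LR : derivable_oo_LRcontinuous (fun t : R => t + F t) 0 (2 * pi).
  split; first by move=> t _; case: (dG t).
    exact/cvg_at_right_filter/cG.
  exact/cvg_at_left_filter/cG.
have dGE : {in `]0, 2 * pi[, derive1 (fun t : R => t + F t) =1 (fun t : R => 1 + k t)}.
  by move=> t _; rewrite derive1E; case: (dG t).
rewrite [X in (_ * X)%E](continuous_FTC2 (twopi_gt0 R) c1k LR dGE).
rewrite -EFinB -EFinM F0 [fine _]/=.
by move: (@pi R) pi0 => p p0; field; rewrite gt_eqF.
Qed.

Lemma zpow_expi (n : nat) (t : R) :
  zpow n (expi t) = cos (n%:R * t) +i* sin (n%:R * t).
Proof.
elim: n => [|n ih]; first by rewrite zpow0 mul0r cos0 sin0.
rewrite intS zpowD zpow1 ih -natr1 mulrDl mul1r addrC cosD sinD.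
by apply/eqP; rewrite eq_complex /=; apply/andP; split; apply/eqP; ring.
Qed.

Lemma expi_2pi : expi (2 * pi) = expi 0 :> circle.
Proof.
by apply: val_inj => /=; rewrite mulr_natl cos2pi sin2pi cos0 sin0.
Qed.

Lemma cintegral_zpow n : cintegral (@zpow R n) = (n == 0)%:R.
Proof.
have pos (k : nat) : cintegral (@zpow R k.+1) = 0.
  have k0 : k.+1%:R != 0 :> R by rewrite pnatr_eq0.
  have [mr mi] := cmeasurable_zpow R k.+1.
  (* Evaluating z^(k+1) at [expi 0] and [expi (2 * pi)], which are the same point, gives both
     antiderivatives equal values at the two endpoints. *)
  have := zpow_expi k.+1 (2 * pi); rewrite expi_2pi zpow_expi mulr0 => -[ec es].
  have clin : continuous (fun t : R => k.+1%:R * t).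
    by move=> t; apply: cvgMr; exact: cvg_id.
  rewrite [RHS](_ : 0 = 0 +i* 0)//; congr (_ +i* _).
    apply: (Rintegral_circle_deriv (k := fun t => cos (k.+1%:R * t))
      (F := fun t => k.+1%:R^-1 * sin (k.+1%:R * t))) => //.
    - by move=> z; rewrite (le_trans (Re_le_cabs _))// cabs_zpow.
    - by move=> t; rewrite zpow_expi.
    - by move=> t; apply: continuous_comp; [exact: clin|exact: continuous_cos].
    - move=> t; apply: is_derive_eq; rewrite /GRing.scale /= mulr1.
      by rewrite ?mulr0 ?addr0; field.
    - by rewrite mulr0 es.
  apply: (Rintegral_circle_deriv (k := fun t => sin (k.+1%:R * t))
      (F := fun t => - k.+1%:R^-1 * cos (k.+1%:R * t))) => //.
  - by move=> z; rewrite (le_trans (Im_le_cabs _))// cabs_zpow.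
  - by move=> t; rewrite zpow_expi.
  - by move=> t; apply: continuous_comp; [exact: clin|exact: continuous_sin].
  - move=> t; apply: is_derive_eq; rewrite /GRing.scale /= mulr1.
    by rewrite ?mulr0 ?addr0; field.
  - by rewrite mulr0 ec.
case: n => [[|k]|k].
- rewrite (eq_cintegral (g := fun=> 1))// /cintegral !Rintegral_cst//.
  by rewrite fine_circle_measureT mulr1 mul0r.
- by rewrite pos.
- rewrite [RHS](_ : _ = (0 : R[i])^*); last by rewrite /= oppr0.
  rewrite -(pos k) -cintegral_conj.
    by apply: eq_cintegral => z; rewrite conj_zpow NegzE.
  have := cintegrable_zpow k.+1 (cintegrable_cst (1 : R[i])).
  by under eq_fun do rewrite mul1r.
Qed.

Lemma L2dot_monomial j k : L2dot (monomial R j) (monomial R k) = (j == k)%:R.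
Proof.
rewrite -fourierE -[in RHS]subr_eq0 -cintegral_zpow.
apply: fourier_cintegral; first exact: cmeasurable_zpow.
by apply: filterS (L2repr_monomial R j) => z ->; rewrite zpowD.
Qed.

Lemma fourier_monomial j k : fourier (monomial R j) k = (j == k)%:R.
Proof. by rewrite fourierE L2dot_monomial. Qed.

End Orthonormality.

(** * The Riesz-Fischer theorem *)

Lemma limn_einf_le (R : realType) (u : (\bar R)^nat) (c : \bar R) :
  (forall n, u n <= c)%E -> (limn_einf u <= c)%E.
Proof.
move=> uc; rewrite limn_einf_lim; apply: lime_le; first exact: is_cvg_einfs.
apply: nearW => n; apply: le_trans (uc n); apply: ereal_inf_lbound.
by exists n => /=.
Qed.

(** * Limits of geometrically Cauchy sequences in L^2 *)

Section L2Complete.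
Context d (T : measurableType d) (R : realType).
Variable mu : {measure set T -> \bar R}.
Variable u : nat -> T -> R.
Hypothesis mu_u : forall n, measurable_fun setT (u n).
Hypothesis cauchy_u : forall i j, (j <= i)%N ->
  (\int[mu]_x ((u i x - u j x) ^+ 2)%:E <= (4^-1 ^+ j)%:E)%E.

Let step n x := u n.+1 x - u n x.
(** The weight 2^n is small enough for the integral to stay below the sum of 2^n 4^-n, which is 2,
    and large enough for finiteness at a point to force absolute convergence of the steps there. *)
Let wsum x := (\sum_(0 <= n <oo) (2 ^+ n * step n x ^+ 2)%:E)%E.

Let measurable_step n : measurable_fun setT (step n).
Proof. exact: measurable_funB. Qed.

Let measurable_term n :
  measurable_fun setT (fun x => (2 ^+ n * step n x ^+ 2)%:E).
Proof.
by apply/measurable_EFinP; apply: measurable_funM => //; exact: measurable_funX.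
Qed.

Let term_ge0 n x : (0 <= (2 ^+ n * step n x ^+ 2)%:E)%E.
Proof. by rewrite lee_fin mulr_ge0 ?sqr_ge0. Qed.

Let integrable_wsum : mu.-integrable setT wsum.
Proof.
have w0 x : (0 <= wsum x)%E by exact: nneseries_ge0.
apply/integrableP; split.
  by apply: ge0_emeasurable_sum => //; move=> k x _ _; exact: term_ge0.
under eq_integral do rewrite gee0_abs//.
rewrite integral_nneseries//.
apply: (@le_lt_trans _ _ (\sum_(0 <= k <oo) (2 / (2 ^ (k + 1))%:R)%:E)%E).
  apply: lee_nneseries => [n _ _|n _]; first exact: integral_ge0.
  under eq_integral do rewrite EFinM.
  rewrite ge0_integralZl//; last 2 first.
    by apply/measurable_EFinP; exact: measurable_funX.
    by move=> x _; rewrite lee_fin sqr_ge0.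
  apply: (@le_trans _ _ ((2 ^+ n)%:E * (4^-1 ^+ n)%:E)%E).
    by rewrite lee_pmul2l ?lte_fin ?exprn_gt0// cauchy_u.
  rewrite -EFinM lee_fin natrX exprD expr1 invfM mulrCA mulfV// mulr1.
  rewrite -exprMn (_ : 2 * 4^-1 = 2^-1 :> R); last by field.
  by rewrite exprVn.
have /cvg_lim -> := @cvg_geometric_eseries_half R 2 0 => //.
exact: ltry.
Qed.

Let cvg_u x : wsum x \is a fin_num -> cvgn (u ^~ x).
Proof.
move=> wfin; suff : cvgn (series (step ^~ x)).
  move=> h; have -> : u ^~ x = (fun=> u 0%N x) \+ series (step ^~ x).
    by apply/funext => n; rewrite [LHS](eq_sum_telescope (u ^~ x)).
  by apply: is_cvgD => //; exact: is_cvg_cst.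
apply: normed_cvg; apply: nondecreasing_is_cvgn.
  by apply: nondecreasing_series => k _ _ /=.
exists (fine (wsum x) + 2) => _ [n _ <-] /=.
have w1 : \sum_(0 <= k < n) 2 ^+ k * step k x ^+ 2 <= fine (wsum x).
  by rewrite -lee_fin fineK// -sumEFin; exact: nneseries_lim_ge.
have w2 : \sum_(0 <= k < n) 2^-1 ^+ k <= 2 :> R.
  elim: n {w1} => [|n _]; first by rewrite big_nil.
  rewrite big_mkord (_ : \sum_(i < n.+1) _ = 2 - 2^-1 ^+ n).
    by rewrite lerBlDr lerDl exprn_ge0.
  elim: n => [|n ih]; first by rewrite big_ord1 expr0; field.
  by rewrite big_ord_recr /= ih exprS; field.
apply: le_trans (lerD w1 w2); rewrite -big_split /=.
apply: ler_sum => k _; set a := `|_|.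
have -> : step k x ^+ 2 = a ^+ 2 by rewrite real_normK ?num_real.
(* AM-GM: 2 a <= e a^2 + 1/e *)
have e0 : 0 < 2 ^+ k :> R by rewrite exprn_gt0.
rewrite exprVn; move: e0; set e := 2 ^+ k => e0.
have : 0 <= e * (a - e^-1) ^+ 2 by rewrite mulr_ge0 ?sqr_ge0// ltW.
rewrite (_ : e * _ = e * a ^+ 2 + e^-1 - 2 * a); last by field; rewrite gt_eqF.
have a0 : 0 <= a by exact: normr_ge0.
by lra.
Qed.

(** [wsum] is finite almost everywhere, so the sequence converges almost everywhere; Fatou applied
    to the squares of u (i + j) - u j carries the Cauchy bound over to the limit. *)
Lemma L2_complete : exists2 g : T -> R, measurable_fun setT g &
  forall j, (\int[mu]_x ((g x - u j x) ^+ 2)%:E <= (4^-1 ^+ j)%:E)%E.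
Proof.
(* An upper limit is measurable whether or not the sequence converges; [fine] turns infinite values
   into 0. *)
pose g x := fine (limn_esup (fun n => (u n x)%:E)).
have mg : measurable_fun setT g.
  apply: measurableT_comp => //; apply: measurable_fun_limn_esup => n.
  exact/measurable_EFinP.
have ae_cvg : {ae mu, forall x, u n x @[n --> \oo] --> g x}.
  apply: filterS (integrable_ae measurableT integrable_wsum) => x /(_ I)/cvg_u.
  move=> /cvg_ex[l ul]; rewrite /g.
  have h : (u n x)%:E @[n --> \oo] --> l%:E.
    by apply: cvg_EFin; [exact: nearW|exact: ul].
  by have [_ ->] := cvg_limn_einf_sup h.
exists g => // j.
pose f (i : nat) x := ((u (i + j)%N x - u j x) ^+ 2)%:E.
have mf i : measurable_fun setT (f i).
  by apply/measurable_EFinP; apply: measurable_funX; exact: measurable_funB.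
have f0 i x : (0 <= f i x)%E by rewrite lee_fin sqr_ge0.
apply: (@le_trans _ _ (\int[mu]_x limn_einf (f ^~ x))%E); last first.
  apply: le_trans (fatou mu measurableT mf (fun n x _ => f0 n x)) _.
  by apply: limn_einf_le => i; apply: cauchy_u; rewrite leq_addl.
apply: ae_ge0_le_integral => //.
- by move=> x _; rewrite lee_fin sqr_ge0.
- by apply/measurable_EFinP; apply: measurable_funX; exact: measurable_funB.
- move=> x _; rewrite limn_einf_lim; apply: lime_ge; first exact: is_cvg_einfs.
  by apply: nearW => n; apply: le_ereal_inf_tmp => _ [k _ <-].
- rewrite /limn_einf; apply: measurableT_comp => //.
  apply: measurable_fun_limn_esup => n; exact: measurableT_comp.
- apply: filterS ae_cvg => x ux _; rewrite le_eqVlt; apply/orP; left; apply/eqP.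
  have h : f ^~ x @ \oo --> ((g x - u j x) ^+ 2)%:E.
    apply: cvg_EFin; first exact: nearW.
    have uj : u (n + j)%N x @[n --> \oo] --> g x by rewrite (cvg_shiftn j (u ^~ x)).
    have ujB : u (n + j)%N x - u j x @[n --> \oo] --> g x - u j x.
      by apply: cvgB => //; exact: cvg_cst.
    rewrite expr2 (_ : fine \o _ =
      (fun n => (u (n + j)%N x - u j x) * (u (n + j)%N x - u j x))).
      exact: cvgM.
    by apply/funext => n; rewrite -expr2.
  by have [->] := cvg_limn_einf_sup h.
Qed.

End L2Complete.

Lemma exists_expr_le (R : realType) (x e : R) : 0 <= x < 1 -> 0 < e ->
  exists n, x ^+ n <= e.
Proof.
move=> /andP[x0 x1] e0.
have /cvgrPdist_le/(_ _ e0) : GRing.exp x @ \oo --> (0 : R).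
  by apply: cvg_expr; rewrite ger0_norm.
move=> [N _ /(_ N (leqnn N))] /=; rewrite sub0r normrN => h; exists N.
exact: le_trans (ler_norm _) h.
Qed.

Lemma nondecreasing_bounded_tail (R : realType) (a : nat -> R) (B e : R) :
  {homo a : i j / (i <= j)%N >-> i <= j} -> (forall n, a n <= B) -> 0 < e ->
  exists N, forall i j, (N <= j)%N -> (j <= i)%N -> a i - a j <= e.
Proof.
move=> na aB e0.
have ca : cvgn a by apply: nondecreasing_is_cvgn => //; exists B => _ [n _ <-].
have /cvgrPdist_le/(_ _ e0) [N _ hN] := ca.
exists N => i j Nj ji; have := hN j Nj; rewrite /= ler_norml => /andP[_].
apply: le_trans; rewrite lerD2r.
exact: (nondecreasing_cvgn_le na ca).
Qed.

Section RieszFischer.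
Variable R : realType.
Local Notation circle := (circle R).
Local Notation m := (circle_measure R).
Local Notation L2 := (L2 R).
Local Notation monomial := (@monomial R).
Implicit Types (f g h : L2) (c : nat -> R[i]).

Definition power_sum c N : L2 := \sum_(k < N) c k *: monomial k.

Lemma power_sumS c N : power_sum c N.+1 = power_sum c N + c N *: monomial N.
Proof. by rewrite /power_sum big_ord_recr. Qed.

Lemma fourier_power_sum c N (n : int) :
  fourier (power_sum c N) n = \sum_(k < N) c k * ((k%:Z == n)%:R).
Proof.
rewrite fourierE L2dot_suml; apply: eq_bigr => k _.
by rewrite L2dotZl -fourierE fourier_monomial.
Qed.

Lemma fourier_power_sum_lt c N (k : nat) : (k < N)%N -> fourier (power_sum c N) k = c k.
Proof.
move=> kN; rewrite fourier_power_sum (bigD1 (Ordinal kN)) //= eqxx mulr1.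
rewrite big1 ?addr0// => i ik; rewrite eqz_nat.
by case: eqP => [ik'|]; rewrite ?mulr0//; case/eqP: ik; apply: val_inj.
Qed.

Lemma fourier_power_sum_ge c N (k : nat) : (N <= k)%N -> fourier (power_sum c N) k = 0.
Proof.
move=> Nk; rewrite fourier_power_sum big1// => i _; rewrite eqz_nat.
by rewrite ltn_eqF ?mulr0// (leq_trans (ltn_ord i)).
Qed.

Lemma fourier_power_sum_neg c N (n : int) : n < 0 -> fourier (power_sum c N) n = 0.
Proof.
move=> n0; rewrite fourier_power_sum big1// => i _.
by rewrite gt_eqF ?mulr0// (lt_le_trans n0).
Qed.

Lemma L2dot_power_sum f c N :
  L2dot f (power_sum c N) = \sum_(k < N) (c k)^* * fourier f k.
Proof.
elim: N => [|N ih].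
  by rewrite /power_sum !big_ord0 L2dotC L2dot0l conjc0.
by rewrite power_sumS L2dotDr ih L2dotZr big_ord_recr /= -fourierE.
Qed.

Lemma sqr_L2norm_monomial n : L2norm (monomial n) ^+ 2 = 1.
Proof.
have /(congr1 (@complex.Re R)) := L2dot_norm (monomial n).
by rewrite L2dot_monomial eqxx complex_ReC.
Qed.

(** Pythagoras: each added monomial is orthogonal to the terms of smaller index. *)
Lemma sqr_L2norm_power_sumB c N k :
  L2norm (power_sum c (N + k) - power_sum c N) ^+ 2 =
  \sum_(i < N + k) cabs (c i) ^+ 2 - \sum_(i < N) cabs (c i) ^+ 2.
Proof.
elim: k => [|k ih].
  by rewrite addn0 !subrr; have := sqr_L2normZ 0 (0 : L2);
    rewrite scale0r => ->; rewrite cabs2 /= !expr0n addr0 mul0r.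
rewrite addnS power_sumS addrAC sqr_L2normD ih sqr_L2normZ sqr_L2norm_monomial.
rewrite L2dotZr -fourierE fourierB !fourier_power_sum_ge ?leq_addr//.
by rewrite subrr mulr0 /= mulr0 addr0 mulr1 big_ord_recr /= addrAC.
Qed.

(** [f - s] is orthogonal to the partial sum [s], so the squared norm of [f] is that of [f - s] plus
    that of [s]. *)
Lemma bessel f N : \sum_(k < N) cabs (fourier f k) ^+ 2 <= L2norm f ^+ 2.
Proof.
set s := power_sum (fun k : nat => fourier f k) N.
have s2 : L2norm s ^+ 2 = \sum_(k < N) cabs (fourier f k) ^+ 2.
  have := sqr_L2norm_power_sumB (fun k : nat => fourier f k) 0 N.
  by rewrite add0n big_ord0 subr0 {2}/power_sum big_ord0 subr0.
have := sqr_L2normD (f - s) s; rewrite subrK L2dot_power_sum big1 => [->|k _].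
  by rewrite /= mulr0 addr0 s2 lerDr sqr_ge0.
by rewrite fourierB fourier_power_sum_lt// subrr mulr0.
Qed.

Lemma integral_cabs2_L2repr f :
  (\int[m]_z (cabs (L2repr f z) ^+ 2)%:E = (L2norm f ^+ 2)%:E)%E.
Proof.
rewrite L2norm_sqr /Rintegral fineK//.
by apply: integrable_fin_num => //; apply: integrable_cabs2; exact: L2fun_L2pred.
Qed.

Lemma cabs_fourier_le f (n : int) : cabs (fourier f n) <= L2norm f.
Proof.
rewrite fourierE (le_trans (cauchy_schwarz _ _))//.
suff -> : L2norm (monomial n) = 1 by rewrite mulr1.
by apply/eqP; rewrite -(eqrXn2 (n := 2)) ?L2norm_ge0// expr1n sqr_L2norm_monomial.
Qed.

(** [L2_complete] is applied to real and imaginary parts; the factor 2 is the sum of the two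
    errors. *)
Lemma L2_function_complete (s : nat -> L2) :
  (forall i j, (j <= i)%N -> L2norm (s i - s j) ^+ 2 <= 4^-1 ^+ j) ->
  exists g, forall j, L2norm (g - s j) ^+ 2 <= 2 * 4^-1 ^+ j.
Proof.
move=> cs.
have ms j := L2repr_cmeasurable (s j).
have reprB (f h : L2) : {ae m, forall z,
    L2repr (f - h) z = (L2repr f z : R[i]) - L2repr h z}.
  have /L2_eqP := subrK h f; apply: filterS2 (L2reprD (f - h) h) => z -> <-.
  by rewrite addrK.
have le_norm (p : R[i] -> R) : (forall w : R[i], p w ^+ 2 <= cabs w ^+ 2) ->
    (forall j, measurable_fun setT (fun z => p (L2repr (s j) z))) ->
    (forall x y : R[i], p (x - y) = p x - p y) ->
    forall i j, (j <= i)%N ->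
    (\int[m]_z ((p (L2repr (s i) z) - p (L2repr (s j) z)) ^+ 2)%:E <= (4^-1 ^+ j)%:E)%E.
  move=> pw mp pB i j ji.
  apply: (@le_trans _ _ (L2norm (s i - s j) ^+ 2)%:E); last by rewrite lee_fin cs.
  rewrite -integral_cabs2_L2repr; apply: ae_ge0_le_integral => //.
  - by move=> z _; rewrite lee_fin sqr_ge0.
  - by apply/measurable_EFinP; apply: measurable_funX; exact: measurable_funB.
  - by move=> z _; rewrite lee_fin sqr_ge0.
  - exact/cmeasurable_cabs2/L2repr_cmeasurable.
  - by apply: filterS (reprB (s i) (s j)) => z -> _; rewrite lee_fin -pB.
have mr j : measurable_fun setT (fun z => Re (L2repr (s j) z)) by case: (ms j).
have mi j : measurable_fun setT (fun z => Im (L2repr (s j) z)) by case: (ms j).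
have [|gr mgr hgr] := @L2_complete _ _ R m (fun j z => Re (L2repr (s j) z)) mr.
  apply: le_norm => // [w|x y]; last exact: raddfB.
  by rewrite cabs2 lerDl sqr_ge0.
have [|gi mgi hgi] := @L2_complete _ _ R m (fun j z => Im (L2repr (s j) z)) mi.
  apply: le_norm => // [w|x y]; last exact: raddfB.
  by rewrite cabs2 lerDr sqr_ge0.
pose G z := gr z +i* gi z.
have mG j : cmeasurable (fun z => G z - L2repr (s j) z).
  split.
    rewrite (_ : (fun z => _) = fun z => gr z - Re (L2repr (s j) z)).
      exact: measurable_funB.
    by apply/funext => z; rewrite raddfB.
  rewrite (_ : (fun z => _) = fun z => gi z - Im (L2repr (s j) z)).
    exact: measurable_funB.
  by apply/funext => z; rewrite raddfB.
have nG j : (\int[m]_z (cabs (G z - L2repr (s j) z) ^+ 2)%:E <= (2 * 4^-1 ^+ j)%:E)%E.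
  under eq_integral do rewrite cabs2 !raddfB /= EFinD.
  rewrite ge0_integralD//.
  - by rewrite mulr_natl mulr2n EFinD leeD.
  - by move=> z _; rewrite lee_fin sqr_ge0.
  - by apply/measurable_EFinP; apply: measurable_funX; exact: measurable_funB.
  - by move=> z _; rewrite lee_fin sqr_ge0.
  - by apply/measurable_EFinP; apply: measurable_funX; exact: measurable_funB.
(* The estimates concern only the differences [G - s j], so the limit is formed as the class of
   [G - s 0] plus [s 0]. *)
have hG : ((fun z => G z - L2repr (s 0%N) z) : circle -> R[i]^o) \in @L2pred R.
  by rewrite inE; split=> //; exact: le_lt_trans (nG 0%N) (ltry _).
exists (toL2 (fun z => G z - L2repr (s 0%N) z) + s 0%N) => j.
set w := toL2 _; rewrite -lee_fin -integral_cabs2_L2repr.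
apply: le_trans (nG j); apply: ae_ge0_le_integral => //.
- by move=> z _; rewrite lee_fin sqr_ge0.
- exact/cmeasurable_cabs2/L2repr_cmeasurable.
- by move=> z _; rewrite lee_fin sqr_ge0.
- exact: cmeasurable_cabs2.
- have := reprB (w + s 0%N) (s j).
  apply: filterS3 (L2reprD w (s 0%N)) (L2repr_toL2 hG) => z h1 h2 ->.
  by rewrite h1 -/w h2 subrK.
Qed.

(** The tails of the convergent sum of squares select a subsequence of partial sums that is
    geometrically Cauchy. Closeness along arbitrarily large [N] is enough to identify coefficients,
    since each partial sum has the right coefficient of index k as soon as N > k. *)
Lemma riesz_fischer c (B : R) : (forall N, \sum_(k < N) cabs (c k) ^+ 2 <= B) ->
  exists g, forall (e : R) M, 0 < e -> exists2 N, (M <= N)%N & L2norm (g - power_sum c N) <= e.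
Proof.
move=> cB; pose a N := \sum_(k < N) cabs (c k) ^+ 2.
have na : {homo a : i j / (i <= j)%N >-> i <= j}.
  by apply/nondecreasing_seqP => i; rewrite /a big_ord_recr /= lerDl sqr_ge0.
have tail j : exists N, forall i k, (N <= k)%N -> (k <= i)%N -> a i - a k <= 4^-1 ^+ j.
  by apply: (nondecreasing_bounded_tail na cB); rewrite exprn_gt0.
have [N0 hN0] := choice tail.
(* Summing the [N0 i + 1] makes [N] monotone and at least as large as both [N0 j] and [j]. *)
pose N j := (\sum_(i < j.+1) (N0 i).+1)%N.
have N0N j : (N0 j <= N j)%N.
  by rewrite /N big_ord_recr /= (leq_trans (leqnSn _))// leq_addl.
have jN j : (j <= N j)%N.
  rewrite /N; elim: j => // j ih; rewrite big_ord_recr /=.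
  by rewrite addnS ltnS (leq_trans ih)// leq_addr.
have homoN : {homo N : i j / (i <= j)%N}.
  apply: homo_leq => [//|x y z|i]; first exact: leq_trans.
  by rewrite /N [leqRHS]big_ord_recr /= leq_addr.
have [g hg] : exists g, forall j, L2norm (g - power_sum c (N j)) ^+ 2 <= 2 * 4^-1 ^+ j.
  apply: (L2_function_complete (s := fun j => power_sum c (N j))) => i j ji.
  rewrite -(subnKC (homoN _ _ ji)) sqr_L2norm_power_sumB subnKC ?homoN//.
  by apply: hN0; rewrite ?homoN.
exists g => e M e0.
have [j hj] : exists j, (4^-1 : R) ^+ j <= e ^+ 2 / 2.
  apply: exists_expr_le; last by rewrite divr_gt0// exprn_gt0.
  by apply/andP; split; lra.
exists (N (maxn j M)); first by rewrite (leq_trans _ (jN _))// leq_maxr.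
rewrite -ler_sqr ?nnegrE ?L2norm_ge0 ?(ltW e0)//.
apply: le_trans (hg _) _.
have : (4^-1 : R) ^+ maxn j M <= 4^-1 ^+ j.
  by apply: ler_wiXn2l; rewrite ?leq_maxl//; lra.
by lra.
Qed.

(** This [g] will be the projection of [f] onto [H2]. Its coefficients are found by comparison with
    the partial sums, because a coefficient is bounded by the norm. *)
Lemma hardy_part f : exists g,
  [/\ forall k : nat, fourier g k = fourier f k, H2 g &
      forall e, 0 < e -> exists N,
        L2norm (g - power_sum (fun k : nat => fourier f k) N) <= e].
Proof.
pose c (k : nat) := fourier f k.
have [g hg] := riesz_fischer (c := c) (bessel f).
have small (x : R) : 0 <= x -> (forall e, 0 < e -> x <= e) -> x = 0.
  move=> x0 xe; apply/le_anti; rewrite x0 andbT.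
  by apply/ler_addgt0Pl => e e0; rewrite addr0; exact: xe.
have cabs_eq0 (x : R[i]) : cabs x = 0 -> x = 0.
  exact: ComplexField.Normc.eq0_normc.
exists g; split.
- move=> k; apply/eqP; rewrite -subr_eq0; apply/eqP/cabs_eq0/small.
    exact: cabs_ge0.
  move=> e e0; have [N kN] := hg e k.+1 e0; apply: le_trans.
  rewrite -[X in _ - X](fourier_power_sum_lt c kN) -fourierB.
  exact: cabs_fourier_le.
- move=> n n0; apply/cabs_eq0/small; first exact: cabs_ge0.
  move=> e e0; have [N _] := hg e 0%N e0; apply: le_trans.
  rewrite -[fourier g n]subr0 -(fourier_power_sum_neg c N n0) -fourierB.
  exact: cabs_fourier_le.
- by move=> e e0; have [N _ hN] := hg e 0%N e0; exists N.
Qed.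

(** An element of [H2] has the same coefficients as its Hardy part, hence equals it. *)
Lemma power_sum_dense f : H2 f -> forall e, 0 < e ->
  exists c N, L2norm (f - power_sum c N) <= e.
Proof.
move=> fH e e0; have [g [gf gH /(_ e e0)[N gN]]] := hardy_part f.
suff -> : f = g by exists (fun k : nat => fourier f k), N.
by apply: fourier_inj => -[k|k]; [rewrite gf|rewrite fH ?gH].
Qed.

Lemma H2_functional_eq0 (phi : L2 -> R[i]) (K : R) :
  (forall f g, phi (f + g) = phi f + phi g) ->
  (forall (a : R[i]) f, phi (a *: f) = a * phi f) ->
  (forall f, cabs (phi f) <= K * L2norm f) ->
  (forall k : nat, phi (monomial k) = 0) ->
  forall f, H2 f -> phi f = 0.
Proof.
move=> phiD phiZ phiK phi0 f fH.
have phi_sum c N : phi (power_sum c N) = 0.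
  elim: N => [|N ih].
    by rewrite /power_sum big_ord0 -(scale0r (0 : L2)) phiZ mul0r.
  by rewrite power_sumS phiD ih phiZ phi0 mulr0 addr0.
apply: ComplexField.Normc.eq0_normc; apply/le_anti; rewrite cabs_ge0 andbT.
apply/ler_addgt0Pl => e e0; rewrite addr0.
(* [K] may be zero or negative; this is a positive bound by which [e] can be divided. *)
have K0 : 0 < `|K| + 1 by rewrite ltr_wpDl.
have [c [N fN]] := power_sum_dense fH (divr_gt0 e0 K0).
have -> : phi f = phi (f - power_sum c N).
  by have := phiD (f - power_sum c N) (power_sum c N); rewrite subrK phi_sum addr0.
apply: le_trans (phiK _) _.
apply: (@le_trans _ _ ((`|K| + 1) * L2norm (f - power_sum c N))).
  by rewrite ler_wpM2r ?L2norm_ge0// (le_trans (ler_norm K))// lerDl.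
by rewrite -ler_pdivlMl// mulrC.
Qed.

End RieszFischer.

(** * The Hardy decomposition and S_(z, zbar) *)

Section HardyDecomposition.
Variable R : realType.
Local Notation circle := (circle R).
Local Notation m := (circle_measure R).
Local Notation L2 := (L2 R).
Local Notation monomial := (@monomial R).
Implicit Types (f g h : L2) (a b : circle -> R[i]) (c : R[i]).

Lemma Linfty_zpow n : Linfty (@zpow R n).
Proof.
split; first exact: cmeasurable_zpow.
by exists 1; apply: aeW => z; rewrite cabs_zpow.
Qed.

Lemma Linfty_conj a : Linfty a -> Linfty (fun z => (a z)^*).
Proof.
move=> [ma [M aM]]; split; first exact: cmeasurable_conj.
by exists M; apply: filterS aM => z; rewrite cabs_conj.
Qed.

Lemma zfunE : @zfun R = zpow 1.
Proof. by apply/funext => z; rewrite zpow1. Qed.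

Lemma zbarfunE : @zbarfun R = zpow (-1).
Proof. by apply/funext => z; rewrite zpowN1. Qed.

Lemma L2repr_mul a f : Linfty a ->
  {ae m, forall z, L2repr (L2mul a f) z = a z * L2repr f z}.
Proof. by move=> ha; apply/L2repr_toL2/L2pred_mul => //; exact: L2fun_L2pred. Qed.

Lemma L2mulD a f g : Linfty a -> L2mul a (f + g) = L2mul a f + L2mul a g.
Proof.
move=> ha; apply/L2_eqP.
apply: filterS3 (L2repr_mul (f + g) ha) (L2reprD f g)
  (filterI (L2reprD (L2mul a f) (L2mul a g))
    (filterI (L2repr_mul f ha) (L2repr_mul g ha))) => z -> -> [-> [-> ->]].
by rewrite mulrDr.
Qed.

Lemma L2mulZ a c f : Linfty a -> L2mul a (c *: f) = c *: L2mul a f.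
Proof.
move=> ha; apply/L2_eqP.
apply: filterS3 (L2repr_mul (c *: f) ha) (L2reprZ c f)
  (filterI (L2reprZ c (L2mul a f)) (L2repr_mul f ha)) => z -> -> [-> ->].
by rewrite mulrCA.
Qed.

Lemma L2mul0 a : Linfty a -> L2mul a (0 : L2) = 0.
Proof. by move=> ha; have := @L2mulZ a 0 0 ha; rewrite !scale0r. Qed.

Lemma L2mulC a b f : Linfty a -> Linfty b ->
  L2mul a (L2mul b f) = L2mul b (L2mul a f).
Proof.
move=> ha hb; apply/L2_eqP.
apply: filterS3 (L2repr_mul (L2mul b f) ha) (L2repr_mul (L2mul a f) hb)
  (filterI (L2repr_mul f ha) (L2repr_mul f hb)) => z h1 h2 [h3 h4].
by rewrite [LHS]h1 [RHS]h2 [in RHS]h3 [in LHS]h4 mulrCA.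
Qed.

Lemma fourier_shift k f n : fourier (L2mul (@zpow R k) f) n = fourier f (n - k).
Proof.
apply: fourier_cintegral.
  exact/cintegrable_measurable/cintegrable_fourier.
apply: filterS (L2repr_mul f (Linfty_zpow k)) => z ->.
rewrite [RHS](_ : _ = L2repr f z * (zpow (n - k) z)^*)//.
by rewrite conj_zpow opprB mulrAC -zpowD mulrC.
Qed.

Lemma fourier_conj f n : fourier (L2conj f) n = (fourier f (- n))^*.
Proof.
rewrite /fourier -cintegral_conj; last exact: cintegrable_fourier.
apply: fourier_cintegral.
  by apply/cmeasurable_conj/cintegrable_measurable/cintegrable_fourier.
have hf := L2pred_conj (L2fun_L2pred (L2repr f)).
apply: filterS (L2repr_toL2 hf) => z ->.
rewrite [RHS](_ : _ = (L2repr f z * (zpow (- n) z)^*)^*)//.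
by rewrite conjcM conjc_involutive.
Qed.

(* Otherwise unification unfolds these operations down to the quotient. *)
Local Opaque L2mul L2conj toL2.

(* J exchanges H2 and H2perp and commutes with S_(z, zbar); conjugating T by J
   reduces every statement on H2perp to one on H2. *)
Definition reflection f : L2 := L2mul (@zpow R (-1)) (L2conj f).
Local Notation J := reflection.

Lemma L2repr_reflection f :
  {ae m, forall z, L2repr (J f) z = zpow (-1) z * (L2repr f z : R[i])^*}.
Proof.
have hf := L2pred_conj (L2fun_L2pred (L2repr f)).
by apply: filterS2 (L2repr_mul (L2conj f) (Linfty_zpow (-1))) (L2repr_toL2 hf)
  => z -> ->.
Qed.

(** The involution n -> -1 - n exchanges the nonnegative indices with the negative ones; the factor
    z^-1 in the reflection is there to produce the -1. *)
Lemma fourier_reflection f n : fourier (J f) n = (fourier f (- 1 - n))^*.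
Proof. by rewrite /J fourier_shift fourier_conj opprK opprD addrC. Qed.

Local Opaque reflection.

Lemma reflectionK f : J (J f) = f.
Proof.
apply: fourier_inj => n; rewrite !fourier_reflection conjc_involutive.
by congr fourier; ring.
Qed.

Lemma reflectionD f g : J (f + g) = J f + J g.
Proof.
apply: fourier_inj => n.
by rewrite (fourier_reflection (f + g)) (fourierD f g) conjcD -!fourier_reflection -fourierD.
Qed.

Lemma reflectionZ c f : J (c *: f) = c^* *: J f.
Proof.
apply: fourier_inj => n.
by rewrite (fourier_reflection (c *: f)) (fourierZ c f) conjcM -fourier_reflection -fourierZ.
Qed.

Lemma L2norm_reflection f : L2norm (J f) = L2norm f.
Proof.
rewrite /L2norm /Rintegral; congr (Num.sqrt (fine _)).
apply: ae_eq_integral => //; [exact/cmeasurable_cabs2/L2repr_cmeasurable..|].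
apply: filterS (L2repr_reflection f) => z -> _.
by rewrite cabsM cabs_zpow mul1r cabs_conj.
Qed.

Lemma reflection_mul a f : Linfty a ->
  J (L2mul a f) = L2mul (fun z => (a z)^*) (J f).
Proof.
move=> ha; apply/L2_eqP.
apply: filterS3 (L2repr_reflection (L2mul a f)) (L2repr_mul f ha)
  (filterI (L2repr_mul (J f) (Linfty_conj ha)) (L2repr_reflection f))
  => z h1 h2 [h3 h4].
by rewrite [LHS]h1 [RHS]h3 h2 h4 conjcM mulrCA.
Qed.

Lemma H2_monomial (k : nat) : H2 (monomial k).
Proof. by move=> n n0; rewrite fourier_monomial gt_eqF// (lt_le_trans n0). Qed.

Lemma H2_0 : H2 (0 : L2).
Proof. by move=> n _; rewrite fourier0. Qed.

(** For the converse, the inner product with [f] is a bounded functional that vanishes at every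
    monomial of [H2]. *)
Lemma H2perpP f : H2perp f <-> forall k : nat, fourier f k = 0.
Proof.
split=> [fH k|f0].
  by rewrite fourierE L2dotC (fH _ (H2_monomial k)) conjc0.
apply: (@H2_functional_eq0 _ (fun g => L2dot g f) (L2norm f)).
- by move=> g h; rewrite L2dotDl.
- by move=> c g; rewrite L2dotZl.
- by move=> g; rewrite mulrC; exact: cauchy_schwarz.
- by move=> k; rewrite L2dotC -fourierE f0 conjc0.
Qed.

Lemma H2_reflection f : H2 (J f) <-> H2perp f.
Proof.
rewrite H2perpP; split=> [fH k|f0 n n0].
  have /(congr1 (@conjc R)) := fH (Negz k) isT.
  rewrite fourier_reflection conjc_involutive conjc0.
  by rewrite NegzE (_ : _ - _ = k%:Z)//; lia.
have [k nk] : exists k : nat, - 1 - n = k.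
  by case: n n0 => // k _; exists k; rewrite NegzE; lia.
by rewrite fourier_reflection nk f0 conjc0.
Qed.

(** The Hardy part is a witness for the choice in [orth_proj], so the default value does not
    intervene. *)
Lemma projH2P f : H2 (projH2 f) /\ H2perp (f - projH2 f).
Proof.
apply: (@xgetPex _ 0 [set g | H2 g /\ orth H2 (f - g)]).
have [g [gf gH _]] := hardy_part f; exists g; split=> //.
by apply/H2perpP => k; rewrite fourierB gf subrr.
Qed.

Lemma projH2_H2 f : H2 (projH2 f). Proof. by case: (projH2P f). Qed.

Lemma projH2perp_H2perp f : H2perp (projH2perp f). Proof. by case: (projH2P f). Qed.

Lemma projH2K f : projH2 f + projH2perp f = f.
Proof. by rewrite /projH2perp addrC subrK. Qed.

Lemma fourier_projH2 f (k : nat) : fourier (projH2 f) k = fourier f k.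
Proof.
rewrite -{2}(projH2K f) fourierD.
by have /H2perpP -> := projH2perp_H2perp f; rewrite addr0.
Qed.

Lemma fourier_projH2perp f n : n < 0 -> fourier (projH2perp f) n = fourier f n.
Proof. by move=> n0; rewrite -{2}(projH2K f) fourierD projH2_H2// add0r. Qed.

Lemma fourier_projH2perp_ge f (k : nat) : fourier (projH2perp f) k = 0.
Proof. by have /H2perpP := projH2perp_H2perp f. Qed.

Lemma projH2_unique f g h : H2 g -> H2perp h -> f = g + h ->
  projH2 f = g /\ projH2perp f = h.
Proof.
move=> gH /H2perpP hH ->; suff E : projH2 (g + h) = g.
  by split=> //; rewrite /projH2perp E addrAC subrr add0r.
apply: fourier_inj => -[k|k].
  by rewrite fourier_projH2 fourierD hH addr0.
by rewrite projH2_H2// gH.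
Qed.

Local Opaque projH2 projH2perp.

Lemma projH2_id f : H2 f -> projH2 f = f /\ projH2perp f = 0.
Proof.
move=> fH; apply: projH2_unique; rewrite ?addr0//.
by apply/H2perpP => k; rewrite fourier0.
Qed.

Lemma projH2perp_id f : H2perp f -> projH2 f = 0 /\ projH2perp f = f.
Proof. by move=> fH; apply: projH2_unique; rewrite ?add0r//; exact: H2_0. Qed.

(** On coefficients this is a pair of one-sided shifts, pushing the nonnegative indices up and the
    negative indices down and leaving zeros at 0 and -1. *)
Definition folded_shift : L2 -> L2 := Sop (@zfun R) (@zbarfun R).
Local Notation U := folded_shift.

Lemma folded_shiftE f :
  U f = L2mul (zpow 1) (projH2 f) + L2mul (zpow (-1)) (projH2perp f).
Proof. by rewrite /folded_shift /Sop zfunE zbarfunE. Qed.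

Local Opaque folded_shift.

Lemma H2_shift f : H2 f -> H2 (L2mul (zpow 1) f).
Proof. by move=> fH n n0; rewrite fourier_shift fH//; lia. Qed.

Lemma H2perp_shift f : H2perp f -> H2perp (L2mul (zpow (-1)) f).
Proof.
move=> /H2perpP fH; apply/H2perpP => k.
by rewrite fourier_shift opprK -PoszD fH.
Qed.

Lemma proj_folded_shift f : projH2 (U f) = L2mul (zpow 1) (projH2 f) /\
  projH2perp (U f) = L2mul (zpow (-1)) (projH2perp f).
Proof.
apply: projH2_unique (folded_shiftE f).
- exact/H2_shift/projH2_H2.
- exact/H2perp_shift/projH2perp_H2perp.
Qed.

Lemma folded_shift_H2 f : H2 f -> U f = L2mul (zpow 1) f.
Proof.
move=> /projH2_id [fP fQ]; rewrite folded_shiftE fP fQ L2mul0 ?addr0//.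
exact: Linfty_zpow.
Qed.

Lemma fourier_folded_shift f : [/\ fourier (U f) 0 = 0,
  forall k : nat, fourier (U f) k.+1 = fourier f k, fourier (U f) (Negz 0) = 0 &
  forall k : nat, fourier (U f) (Negz k.+1) = fourier f (Negz k)].
Proof.
have Pn n : n < 0 -> fourier (projH2 f) n = 0 by exact: projH2_H2.
have Qk := fourier_projH2perp_ge f.
split=> [|k||k]; rewrite folded_shiftE fourierD !fourier_shift opprK.
- by rewrite Pn// [LHS]add0r; exact: (Qk 1%N).
- rewrite (_ : k.+1%:Z + 1 = k.+2%:Z); last by lia.
  by rewrite Qk addr0 (_ : _ - 1 = k%:Z) ?fourier_projH2//; lia.
- by rewrite Pn// [LHS]add0r; exact: (Qk 0%N).
- rewrite Pn ?add0r; last by lia.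
  by rewrite (_ : _ + 1 = Negz k) ?fourier_projH2perp//; lia.
Qed.

Lemma reflection_folded_shift f : J (U f) = U (J f).
Proof.
have [F0 Fk Fm1 Fm] := fourier_folded_shift f.
have [G0 Gk Gm1 Gm] := fourier_folded_shift (J f).
apply: fourier_inj => -[[|k]|[|k]]; rewrite (fourier_reflection (U f)).
- by rewrite [RHS]G0 (_ : - 1 - 0%N%:Z = Negz 0)// Fm1 conjc0.
- rewrite [RHS]Gk (fourier_reflection f) (_ : - 1 - k.+1%:Z = Negz k.+1); last by lia.
  by rewrite Fm (_ : - 1 - k%:Z = Negz k)//; lia.
- by rewrite [RHS]Gm1 (_ : - 1 - Negz 0 = 0%N)// [fourier _ _]F0 conjc0.
- rewrite [RHS]Gm (fourier_reflection f) (_ : - 1 - Negz k.+1 = k.+1); last by lia.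
  by rewrite Fk (_ : - 1 - Negz k = k)//; lia.
Qed.

End HardyDecomposition.

(** * Operators with analytic and co-analytic symbols *)

Section AnalyticSymbols.
Variable R : realType.
Local Notation circle := (circle R).
Local Notation L2 := (L2 R).
Local Notation monomial := (@monomial R).
Implicit Types (f g h : L2) (a b : circle -> R[i]) (c : R[i]).

Local Opaque L2mul L2conj toL2 reflection projH2 projH2perp folded_shift.

(** With a representing vector, the bound required by [H2_functional_eq0] is just Cauchy-Schwarz. *)
Lemma fourier_L2mul a : Linfty a -> forall n, exists w : L2,
  forall f, fourier (L2mul a f) n = L2dot f w.
Proof.
move=> ha n.
have hw : ((fun z => (a z * zpow (- n) z)^*) : circle -> R[i]^o) \in @L2pred R.
  apply/L2pred_conj; apply: L2pred_mul => //; exact: zpow_L2pred.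
exists (toL2 (fun z => (a z * zpow (- n) z)^*)) => f; apply: fourier_cintegral.
  exact/cintegrable_measurable/cintegrable_dot.
apply: filterS2 (L2repr_mul f ha) (L2repr_toL2 hw) => z -> E.
rewrite [RHS](_ : _ = L2repr f z * (a z * zpow (- n) z)).
  by rewrite mulrA [X in X * _]mulrC.
by congr (_ * _); rewrite -[RHS]conjc_involutive; congr conjc.
Qed.

Lemma L2mul_monomial a k : Linfty a -> L2mul a (monomial k) = L2mul (zpow k) (toL2 a).
Proof.
move=> ha; apply/L2_eqP.
apply: filterS3 (L2repr_mul (monomial k) ha) (L2repr_mul (toL2 a) (Linfty_zpow R k))
  (filterI (L2repr_monomial R k) (L2repr_toL2 (Linfty_L2pred ha))) => z h1 h2 [h3 h4].
by rewrite [LHS]h1 [RHS]h2 h3 h4 mulrC.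
Qed.

(** For n < 0 the coefficient of index n of a f is a bounded functional of [f]; at z^k it equals the
    coefficient of [a] of index n - k, which is again negative. *)
Lemma H2_analytic_mul a f : Linfty a -> analytic (toL2 a) -> H2 f -> H2 (L2mul a f).
Proof.
move=> ha aH fH n n0; have [w hw] := fourier_L2mul ha n.
apply: (@H2_functional_eq0 _ (fun f => fourier (L2mul a f) n) (L2norm w)) => //.
- by move=> g h; rewrite L2mulD// fourierD.
- by move=> c g; rewrite L2mulZ// fourierZ.
- by move=> g; rewrite hw mulrC; exact: cauchy_schwarz.
- by move=> k; rewrite L2mul_monomial// fourier_shift aH//; lia.
Qed.

Lemma L2conj_toL2 b : Linfty b -> L2conj (toL2 b) = toL2 (fun z => (b z)^*).
Proof.
move=> hb; apply/L2_eqP.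
have hb2 := Linfty_L2pred hb.
have hb1 := L2pred_conj (L2fun_L2pred (L2repr (toL2 b))).
apply: filterS3 (L2repr_toL2 hb1) (L2repr_toL2 (L2pred_conj hb2)) (L2repr_toL2 hb2).
by move=> z h1 h2 h3; rewrite [LHS]h1 [RHS]h2 h3.
Qed.

Lemma H2perp_coanalytic_mul b f : Linfty b -> coanalytic (toL2 b) ->
  H2perp f -> H2perp (L2mul b f).
Proof.
move=> hb bH fH; apply: (proj1 (H2_reflection (L2mul b f))).
rewrite (reflection_mul f hb); apply: H2_analytic_mul (Linfty_conj hb) _ _.
  by rewrite -(L2conj_toL2 hb).
exact: (proj2 (H2_reflection f)).
Qed.

Lemma monomial_neq0 n : monomial n != 0.
Proof.
apply/eqP => /(congr1 (fun f => fourier f n)) /eqP.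
by rewrite fourier_monomial fourier0 eqxx oner_eq0.
Qed.

Lemma H2perp_monomial (k : nat) : H2perp (monomial (Negz k)).
Proof. by apply/H2perpP => j; rewrite fourier_monomial. Qed.

Section Sop.
Variables (a b : circle -> R[i]).
Hypotheses (ha : Linfty a) (hb : Linfty b).
Hypotheses (aH : analytic (toL2 a)) (bH : coanalytic (toL2 b)).

Lemma proj_Sop f : projH2 (Sop a b f) = L2mul a (projH2 f) /\
  projH2perp (Sop a b f) = L2mul b (projH2perp f).
Proof.
apply: projH2_unique; last by rewrite /Sop.
- exact: H2_analytic_mul ha aH (projH2_H2 f).
- exact: H2perp_coanalytic_mul hb bH (projH2perp_H2perp f).
Qed.

Lemma Sop_folded_shift f :
  Sop a b (folded_shift f) = folded_shift (Sop a b f).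
Proof.
rewrite [RHS]folded_shiftE; have [-> ->] := proj_Sop f.
rewrite /Sop; have [-> ->] := proj_folded_shift f.
by rewrite (L2mulC _ ha (Linfty_zpow R 1)) (L2mulC _ hb (Linfty_zpow R (-1))).
Qed.

Lemma Sop_H2 f : H2 f -> H2 (Sop a b f).
Proof.
move=> fH; have [fP fQ] := projH2_id fH.
by rewrite /Sop fP fQ (L2mul0 hb) addr0; exact: H2_analytic_mul.
Qed.

Lemma Sop_H2perp f : H2perp f -> H2perp (Sop a b f).
Proof.
move=> fH; have [fP fQ] := projH2perp_id fH.
by rewrite /Sop fP fQ (L2mul0 ha) add0r; exact: H2perp_coanalytic_mul.
Qed.

End Sop.
End AnalyticSymbols.

(** * Operators commuting with S_(z, zbar) *)

(** Markov's inequality for h^j bounds the measure of the set where h > 2K by 2^-j, for every j. *)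
Lemma ae_le_of_moments d (T : measurableType d) (R : realType)
    (mu : {measure set T -> \bar R}) (h : T -> R) (K : R) :
  measurable_fun setT h -> (forall x, 0 <= h x) -> 0 < K ->
  (forall j : nat, \int[mu]_x (h x ^+ j)%:E <= (K ^+ j)%:E)%E ->
  {ae mu, forall x, h x <= 2 * K}.
Proof.
move=> mh h0 K0 hK; pose A := [set x | 2 * K < h x].
have mA : measurable A.
  rewrite /A -[X in measurable X]setTI.
  exact: (measurable_fun_ltr (measurable_cst (2 * K)) mh).
have muA j : (mu A <= (2^-1 ^+ j)%:E)%E.
  have mhj : measurable_fun setT (fun x => (h x ^+ j)%:E).
    by apply/measurable_EFinP; exact: measurable_funX.
  have : (((2 * K) ^+ j)%:E * mu A <= (K ^+ j)%:E)%E.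
    apply: le_trans (hK j); rewrite -integral_cst//.
    apply: (@le_trans _ _ (\int[mu]_(x in A) (h x ^+ j)%:E)%E).
      apply: ge0_le_integral => //.
      - by move=> x _; rewrite lee_fin exprn_ge0// mulr_ge0// ltW.
      - exact: measurable_funS mhj.
      - move=> x /= Ax; rewrite lee_fin lerXn2r// ?nnegrE ?mulr_ge0 ?(ltW K0)//.
        exact: ltW.
    apply: ge0_subset_integral => //.
    by move=> x _; rewrite lee_fin exprn_ge0.
  rewrite -lee_pdivlMl ?exprn_gt0 ?mulr_gt0// => /le_trans; apply.
  by rewrite -EFinM lee_fin exprMn invfM -mulrA mulVf ?mulr1 ?exprVn// expf_neq0// gt_eqF.
have nA : ~` [set x | h x <= 2 * K] = A.
  by apply/seteqP; split => x /= => [/negP|Ax]; [|apply/negP]; rewrite -ltNge.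
apply/negligibleP; rewrite nA//.
apply/le_anti; rewrite measure_ge0 andbT.
have fA : mu A \is a fin_num.
  by rewrite ge0_fin_numE// (le_lt_trans (muA 0%N))// ltry.
suff m0 : (mu A <= 0)%E by exact: m0.
rewrite -(fineK fA) lee_fin; apply/ler_addgt0Pl => e e0; rewrite addr0.
have [j] : exists j, (2^-1 : R) ^+ j <= e.
  by apply: exists_expr_le => //; apply/andP; split; lra.
by apply: le_trans; rewrite -lee_fin fineK.
Qed.

(** * The action on [H2] *)

Section Intertwiner.
Variable R : realType.
Local Notation circle := (circle R).
Local Notation m := (circle_measure R).
Local Notation L2 := (L2 R).
Local Notation monomial := (@monomial R).
Local Notation U := (@folded_shift R).
Implicit Types (f g h : L2) (a b : circle -> R[i]) (c : R[i]).

Local Opaque L2mul L2conj toL2 reflection projH2 projH2perp folded_shift.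

Variable T : L2 -> L2.
Hypothesis TD : forall f g, T (f + g) = T f + T g.
Hypothesis TZ : forall c f, T (c *: f) = c *: T f.
Hypothesis TU : forall f, T (U f) = U (T f).

(** [g] is the backward shift z^-1 (f - f^(0)); it stays in [H2], where [U] is multiplication by z
    and undoes the division. *)
Lemma H2_split f : H2 f -> exists g,
  [/\ H2 g, f = fourier f 0 *: monomial 0 + U g &
      forall k : nat, fourier f k.+1 = fourier g k].
Proof.
move=> fH; pose r := f - fourier f 0 *: monomial 0.
have rE n : fourier r n = fourier f n - fourier f 0 * (0 == n)%:R.
  by rewrite /r fourierB fourierZ fourier_monomial.
have gH : H2 (L2mul (zpow (-1)) r).
  move=> n n0; rewrite fourier_shift opprK rE.
  case: eqP => [<-|n1]; first by rewrite mulr1 subrr.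
  by rewrite mulr0 subr0 fH//; lia.
have fE : f = fourier f 0 *: monomial 0 + U (L2mul (zpow (-1)) r).
  suff -> : U (L2mul (zpow (-1)) r) = r by rewrite /r addrC subrK.
  rewrite (folded_shift_H2 gH); apply: fourier_inj => n.
  by rewrite !fourier_shift opprK subrK.
exists (L2mul (zpow (-1)) r); split=> // k.
rewrite [in LHS]fE fourierD fourierZ fourier_monomial mulr0 add0r.
by have [_ -> _ _] := fourier_folded_shift (L2mul (zpow (-1)) r).
Qed.

Lemma intertwiner_split f g n : f = fourier f 0 *: monomial 0 + U g ->
  fourier (T f) n = fourier f 0 * fourier (T (monomial 0)) n + fourier (U (T g)) n.
Proof. by move=> fE; rewrite [in LHS]fE TD TZ TU fourierD fourierZ. Qed.

Lemma exists_fourier0_neq0 (k : nat) f : H2 f -> fourier f k != 0 -> H2 (T f) ->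
  exists g, [/\ H2 g, fourier g 0 != 0 & H2 (T g)].
Proof.
elim: k f => [|k ih] f fH fk TfH; first by exists f.
have [f0|f0] := eqVneq (fourier f 0) 0; last by exists f.
have [g [gH fE fg]] := H2_split fH.
apply: (ih g) => //; first by rewrite -fg.
(* As f^(0) = 0, T f = U (T g); the coefficient of T g of index -j-1 reappears in T f at index -j-2,
   where it vanishes. *)
move=> [//|j] _; have [_ _ _ <-] := fourier_folded_shift (T g).
have := intertwiner_split (Negz j.+1) fE; rewrite f0 mul0r add0r => <-.
exact: TfH.
Qed.

Lemma intertwiner_H2 f0 : H2 f0 -> f0 != 0 -> H2 (T f0) -> forall f, H2 f -> H2 (T f).
Proof.
move=> f0H f0n0 Tf0H.
have [k fk] : exists k : nat, fourier f0 k != 0.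
  apply: contrapT => nk; move/eqP: f0n0; apply.
  apply: fourier_eq0 => -[k|k]; last exact: f0H.
  by apply/eqP/negPn/negP => fk; apply: nk; exists k.
have [g0 [g0H g00 Tg0H]] := exists_fourier0_neq0 f0H fk Tf0H.
have [g1 [g1H g0E _]] := H2_split g0H.
suff main N : forall k, (k < N)%N -> forall f, H2 f -> fourier (T f) (Negz k) = 0.
  by move=> f fH [//|j] _; exact: (main j.+1).
elim: N => [//|N ih] j; rewrite ltnS => jN.
have UT g : H2 g -> fourier (U (T g)) (Negz j) = 0.
  move=> gH; have [_ _ F0 FS] := fourier_folded_shift (T g).
  by case: j jN => [_|j jN]; [exact: F0|rewrite FS ih].
(* In the splitting of [g0] the coefficient of T g0 and the one coming from [U] both vanish, which
   leaves the nonzero g0^(0) times the coefficient sought. *)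
have T1 : fourier (T (monomial 0)) (Negz j) = 0.
  have := intertwiner_split (Negz j) g0E; rewrite UT// addr0 Tg0H// => /esym/eqP.
  by rewrite mulf_eq0 (negbTE g00) => /eqP.
move=> f fH; have [g [gH fE _]] := H2_split fH.
by rewrite (intertwiner_split _ fE) T1 mulr0 add0r UT.
Qed.

Hypothesis hT : bounded_operator T.
Hypothesis TH : forall f, H2 f -> H2 (T f).

Let alpha : circle -> R[i] := L2repr (T (monomial 0)).

(** [TH] enters because [U] is multiplication by z only on [H2]: T z^k has to stay there for the
    induction to continue. *)
Lemma intertwiner_monomial (k : nat) : T (monomial k) = L2mul (zpow k) (T (monomial 0)).
Proof.
elim: k => [|k ih].
  by apply: fourier_inj => n; rewrite fourier_shift subr0.
have -> : monomial k.+1 = U (monomial k).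
  rewrite (folded_shift_H2 (H2_monomial R k)).
  apply: fourier_inj => n; rewrite fourier_shift !fourier_monomial.
  by congr (nat_of_bool _)%:R; lia.
rewrite TU ih (folded_shift_H2 _).
  by apply: fourier_inj => n; rewrite !fourier_shift; congr fourier; lia.
by rewrite -ih; exact/TH/H2_monomial.
Qed.

(** The two sides are compared in L^1 through their Fourier coefficients. At a fixed index both
    coefficients are bounded functionals of [f] in L^2, the one of alpha f being the inner product
    with the conjugate of alpha z^n, and they agree at monomials. *)
Lemma intertwiner_ae_mul f : H2 f ->
  {ae m, forall z, L2repr (T f) z = alpha z * L2repr f z :> R[i]}.
Proof.
move=> fH.
have alpha2 : (alpha : circle -> R[i]^o) \in @L2pred R by exact: L2fun_L2pred.
have afi g : cintegrable (fun z => alpha z * L2repr g z).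
  by apply: cintegrable_L2M => //; exact: L2fun_L2pred.
have Tfi : cintegrable (L2repr (T f) : circle -> R[i]).
  have := cintegrable_fourier (T f) 0.
  by under eq_fun do rewrite (_ : _ ^ 0 = 1)// conjc1 mulr1.
suff /zero_fourier_ae0 : zero_fourier (fun z => L2repr (T f) z + (-1) * (alpha z * L2repr f z)).
  by apply: filterS => z /eqP; rewrite mulN1r subr_eq0 => /eqP.
split; first by apply: cintegrableD => //; exact: cintegrableZ.
move=> n.
have w2 : ((fun z => (alpha z * zpow n z)^*) : circle -> R[i]^o) \in @L2pred R.
  apply: L2pred_conj; have := L2pred_mul (Linfty_zpow R n) alpha2.
  by under [X in X \in _ -> _]eq_fun do rewrite mulrC.
pose w : L2 := toL2 (fun z => (alpha z * zpow n z)^*).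
have wE g : cintegral (fun z => alpha z * L2repr g z * zpow n z) = L2dot g w.
  apply: ae_eq_cintegral.
  - exact/cintegrable_measurable/cintegrable_zpow.
  - exact/cintegrable_measurable/cintegrable_dot.
  - apply: filterS (L2repr_toL2 w2) => z hz.
    rewrite [RHS](_ : _ = L2repr g z * (L2repr w z : R[i])^*)// hz conjc_involutive.
    by rewrite mulrAC mulrC.
have TE g : cintegral (fun z => L2repr (T g) z * zpow n z) = fourier (T g) (- n).
  apply/esym/fourier_cintegral; last by apply: aeW => z; rewrite opprK.
  apply: cmeasurableM; [exact: L2repr_cmeasurable|exact: cmeasurable_zpow].
pose phi g := fourier (T g) (- n) - L2dot g w.
suff phi0 : phi f = 0.
  rewrite -[RHS]phi0 /phi -TE -wE.
  under eq_cintegral do rewrite mulrDl -mulrA.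
  rewrite cintegralD; last 2 first.
  - exact: cintegrable_zpow.
  - exact/cintegrableZ/cintegrable_zpow.
  by rewrite cintegralZ ?mulN1r//; exact: cintegrable_zpow.
have [C TC] := hT.
apply: (@H2_functional_eq0 _ phi (C + L2norm w)) => //.
- by move=> g h; rewrite /phi TD fourierD L2dotDl; ring.
- by move=> c g; rewrite /phi TZ fourierZ L2dotZl; ring.
- move=> g; rewrite /phi mulrDl.
  have cabsB (x y : R[i]) : cabs (x - y) <= cabs x + cabs y.
    have -> : cabs y = cabs (- y) by case: y => p q; rewrite /cabs /= !sqrrN.
    exact: le_normcD.
  apply: le_trans (cabsB _ _) _; apply: lerD.
    exact: le_trans (cabs_fourier_le _ _) (TC g).
  by rewrite mulrC; exact: cauchy_schwarz.
- move=> k; rewrite /phi intertwiner_monomial fourier_shift -wE; apply/eqP; rewrite subr_eq0.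
  apply/eqP; apply: fourier_cintegral.
    exact/cintegrable_measurable/cintegrable_zpow.
  apply: filterS (L2repr_monomial R k) => z ->.
  by rewrite -mulrA -zpowD; congr (_ * zpow _ z); lia.
Qed.

Lemma H2_iter j : H2 (iter j T (monomial 0)).
Proof. by elim: j => [|j ih]; [exact: (H2_monomial R 0)|rewrite iterS; exact: TH]. Qed.

Lemma iter_ae_pow j :
  {ae m, forall z, L2repr (iter j T (monomial 0)) z = alpha z ^+ j :> R[i]}.
Proof.
elim: j => [|j ih]; first by apply: filterS (L2repr_monomial R 0) => z ->.
by apply: filterS2 ih (intertwiner_ae_mul (H2_iter j)) => z h1 h2; rewrite iterS h2 h1 exprS.
Qed.

Lemma Linfty_alpha : Linfty alpha.
Proof.
have malpha : cmeasurable alpha by exact: L2repr_cmeasurable.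
(* The moments used are those of |alpha|^2: the integral of |alpha|^(2j) is the squared norm of T^j
   1. The added 1 keeps [K] positive even when C = 0. *)
split=> //; have [C TC] := hT; pose K := C ^+ 2 + 1.
have K0 : 0 < K by rewrite ltr_wpDl ?sqr_ge0.
have iterC j : L2norm (iter j T (monomial 0)) ^+ 2 <= K ^+ j.
  elim: j => [|j ih]; first by rewrite /= sqr_L2norm_monomial expr0.
  rewrite iterS [K ^+ _]exprS; apply: (@le_trans _ _ ((C * L2norm (iter j T (monomial 0))) ^+ 2)).
    by rewrite lerXn2r ?nnegrE ?L2norm_ge0// (le_trans _ (TC _)) ?L2norm_ge0.
  rewrite exprMn ler_pM ?sqr_ge0//.
  by rewrite /K lerDl.
have : {ae m, forall z, cabs (alpha z) ^+ 2 <= 2 * K}.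
  apply: ae_le_of_moments => //.
  - by apply/measurable_EFinP; exact: cmeasurable_cabs2.
  - by move=> z; exact: sqr_ge0.
  - move=> j; apply: (@le_trans _ _ (L2norm (iter j T (monomial 0)) ^+ 2)%:E).
      rewrite -integral_cabs2_L2repr le_eqVlt; apply/orP; left; apply/eqP.
      apply: ae_eq_integral => //.
      - apply/measurable_EFinP/measurable_funX/measurable_EFinP.
        exact: cmeasurable_cabs2.
      - exact/cmeasurable_cabs2/L2repr_cmeasurable.
      - apply: filterS (iter_ae_pow j) => z -> _; congr EFin.
        by rewrite exprAC; congr (_ ^+ 2); elim: j => [|j ih];
          rewrite ?expr0 ?cabs1// !exprS cabsM ih.
    by rewrite lee_fin.
(* From 2x <= x^2 + 1 the bound on |alpha|^2 yields one on |alpha| without a square root. *)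
move=> aK; exists (2 * K + 1); apply: filterS aK => z.
have := cabs_ge0 (alpha z); move: (cabs _) => x x0 x2.
by have := sqr_ge0 (x - 1); rewrite sqrrB expr1n mulr1; lra.
Qed.

Lemma analytic_symbol_ex : exists a, [/\ Linfty a, analytic (toL2 a) &
  forall f, H2 f -> T f = L2mul a f].
Proof.
exists alpha; split; first exact: Linfty_alpha.
  by rewrite toL2_repr; exact/TH/(H2_monomial R 0).
move=> f fH; apply/L2_eqP.
by apply: filterS2 (intertwiner_ae_mul fH) (L2repr_mul f Linfty_alpha) => z h1 h2;
  rewrite [LHS]h1 [RHS]h2.
Qed.

End Intertwiner.

(** * Transfer to the complement of [H2] *)

Section CoanalyticSymbol.
Variable R : realType.
Local Notation L2 := (L2 R).
Local Notation J := (@reflection R).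

Local Opaque L2mul L2conj toL2 reflection projH2 projH2perp folded_shift.

(** The two conjugate-linear factors J cancel, so [T'] is again linear. Moving J past multiplication
    by the analytic symbol a of [T'] conjugates a, which gives the co-analytic symbol of [T]. *)
Lemma coanalytic_symbol_ex (T : L2 -> L2) (g : L2) :
  (forall f g, T (f + g) = T f + T g) ->
  (forall (c : R[i]) f, T (c *: f) = c *: T f) ->
  (forall f, T (folded_shift f) = folded_shift (T f)) ->
  bounded_operator T -> H2perp g -> g != 0 -> H2perp (T g) ->
  exists b, [/\ Linfty b, coanalytic (toL2 b) &
    forall f, H2perp f -> T f = L2mul b f].
Proof.
move=> TD TZ TU hT gH g0 TgH; pose T' u := J (T (J u)).
have TD' u v : T' (u + v) = T' u + T' v.
  by rewrite /T' (reflectionD u v) TD reflectionD.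
have TZ' (c : R[i]) u : T' (c *: u) = c *: T' u.
  by rewrite /T' (reflectionZ c u) TZ reflectionZ conjc_involutive.
have TU' u : T' (folded_shift u) = folded_shift (T' u).
  by rewrite -[RHS]reflection_folded_shift -TU -reflection_folded_shift.
have hT' : bounded_operator T'.
  have [C TC] := hT; exists C => u.
  by rewrite /T' (L2norm_reflection (T (J u))) -(L2norm_reflection u).
have Jg0 : J g != 0.
  apply/eqP => Jg0; move/eqP: g0; apply.
  rewrite -(reflectionK g) Jg0.
  by have := reflectionZ 0 (0 : L2); rewrite conjc0 !scale0r.
have T'gH : H2 (T' (J g)).
  by rewrite /T' reflectionK; exact: (proj2 (H2_reflection (T g))).
have T'H := intertwiner_H2 TD' TZ' TU' (proj2 (H2_reflection g) gH) Jg0 T'gH.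
have [a [ha aH T'a]] := analytic_symbol_ex TD' TZ' TU' hT' T'H.
exists (fun z => (a z)^*); split; first exact: Linfty_conj.
  rewrite /coanalytic (L2conj_toL2 (Linfty_conj ha)).
  by under eq_fun do rewrite conjc_involutive.
move=> f fH; have -> : T f = J (T' (J f)).
  exact: etrans (congr1 T (esym (reflectionK f))) (esym (reflectionK (T (J (J f))))).
by rewrite (T'a _ (proj2 (H2_reflection f) fH)) (reflection_mul (J f) ha) (reflectionK f).
Qed.

End CoanalyticSymbol.

Theorem theorem4p3 (R : realType) (T : {linear L2 R -> L2 R})
    (hT : bounded_operator T) :
  (exists a b : circle R -> R[i],
      [/\ Linfty a, Linfty b, analytic (toL2 a), coanalytic (toL2 b)
        & forall f : L2 R, T f = Sop a b f])
  <->
  ((forall f : L2 R,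
      T (Sop (@zfun R) (@zbarfun R) f) = Sop (@zfun R) (@zbarfun R) (T f)) /\
   T @` (H2 `\ 0) `&` H2 !=set0 /\
   T @` (H2perp `\ 0) `&` H2perp !=set0).
Proof.
split.
  move=> [a [b [ha hb aH bH TE]]]; split; last split.
  - move=> f; rewrite !TE; exact: (Sop_folded_shift ha hb aH bH f).
  (* The nonzero witnesses for condition (ii) are 1 in [H2] and z^-1 in [H2perp]. *)
  - exists (T (monomial R 0)); split.
      exists (monomial R 0); last exact: erefl.
      by split; [exact: (H2_monomial R 0)|exact/eqP/monomial_neq0].
    by rewrite TE; apply: (Sop_H2 ha hb aH); exact: (H2_monomial R 0).
  - exists (T (monomial R (Negz 0))); split.
      exists (monomial R (Negz 0)); last exact: erefl.
      by split; [exact: H2perp_monomial|exact/eqP/monomial_neq0].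
    by rewrite TE; apply: (Sop_H2perp ha hb bH); exact: H2perp_monomial.
move=> [TU [[_ [[f [fH f0] <-] TfH]] [_ [[g [gH g0] <-] TgH]]]].
have TD u v : T (u + v) = T u + T v by exact: raddfD.
have TZ (c : R[i]) u : T (c *: u) = c *: T u by exact: linearZ.
have [a [ha aH Ta]] : exists a, [/\ Linfty a, analytic (toL2 a) &
    forall f, H2 f -> T f = L2mul a f].
  apply: (analytic_symbol_ex TD TZ TU hT).
  by apply: (intertwiner_H2 TD TZ TU fH _ TfH); apply/eqP.
have [b [hb bH Tb]] : exists b, [/\ Linfty b, coanalytic (toL2 b) &
    forall f, H2perp f -> T f = L2mul b f].
  by apply: (coanalytic_symbol_ex TD TZ TU hT gH _ TgH); apply/eqP.
exists a, b; split; [exact: ha|exact: hb|exact: aH|exact: bH|move=> u].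
by rewrite /Sop -(Ta _ (projH2_H2 u)) -(Tb _ (projH2perp_H2perp u)) -TD projH2K.
Qed.
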